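(* Let $s\in(0,1)$, let $\Omega$ be an open subset of $\mathbb{R}^n$ of class $C^{1,1}$, and let $x_0\in\partial\Omega$. Let $u\in C^s(\Omega)\cap L^\infty(\Omega)$ be such that $$\begin{cases}(-\Delta)^su=V(x)\,u&\text{in }\Omega,\\ u=0&\text{in }\mathbb{R}^n\setminus\Omega,\end{cases}$$ with $u>0$ (respectively $u<0$) in $B_R(x_0)\cap\Omega$, for some $R>0$ and $V\in L^\infty(\Omega)$. If $u$ grows faster than the power $2s$ at $x_0$, then $$\frac{|u|}{d^s}(x_0)>0.$$
   Context: $(-\Delta)^s$ is the fractional Laplacian, i.e. up to a positive normalization constant $(-\Delta)^sw(x)=PV\int_{\mathbb{R}^n}\frac{w(x)-w(x+y)}{|y|^{n+2s}}\,dy$, with $PV$ the principal value. $d(x):=\mathrm{dist}(x,\partial\Omega)$, and $\frac{|u|}{d^s}(x_0)$ denotes the value at $x_0$ of the continuous extension of $|u|/d^s$ up to $\partial\Omega$. Since $\Omega$ is of class $C^{1,1}$, it satisfies an interior sphere condition at $x_0$: there exists $\bar r>0$ such that, for every $r\in(0,\bar r]$, there exists a ball $B_r(x_r)\subseteq\Omega$ with $x_0\in(\partial\Omega)\cap(\partial B_r(x_r))$. Growth condition: given a continuous function $u:\mathbb{R}^n\to\mathbb{R}$ with $u(x_0)=0$ and $|u|>0$ in $B_r(x_r)$ for every sufficiently small $r$, we say that $u$ grows faster than the power $2s$ at $x_0$ if $\limsup_{r\to0^+}\Phi(r)=+\infty$, where $\Phi(r):=\frac{\inf_{B_{r/2}(x_r)}|u|}{r^{2s}}$.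 *)

(* Defs.v *)
From HB Require Import structures.
From mathcomp Require Import all_boot all_order all_algebra.
From mathcomp Require Import all_classical all_reals all_analysis.

Set Implicit Arguments.
Unset Strict Implicit.
Unset Printing Implicit Defensive.
Import Order.TTheory GRing.Theory Num.Theory.
Import numFieldNormedType.Exports.
Local Open Scope classical_set_scope.
Local Open Scope ring_scope.

(* Row vectors with the sigma-algebra generated by the coordinates (the Borel
   sets), on which [lebesgue_rV] is the n-dimensional Lebesgue measure. *)
Definition rV_display : measure_display -> measure_display.
Proof. exact. Qed.

Section measurable_rV.
Context {R : realType} (n : nat).

Definition rV_coord (i : 'I_n) (x : 'rV[R]_n) : measurableTypeR R := x 0 i.

Let rV_set0 : g_sigma_preimage rV_coord set0.
Proof. exact: sigma_algebra0. Qed.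

Let rV_setC A : g_sigma_preimage rV_coord A -> g_sigma_preimage rV_coord (~` A).
Proof. exact: sigma_algebraC. Qed.

Let rV_bigcup (F : _^nat) : (forall i, g_sigma_preimage rV_coord (F i)) ->
  g_sigma_preimage rV_coord (\bigcup_i (F i)).
Proof. exact: sigma_algebra_bigcup. Qed.

HB.instance Definition _ := @isMeasurable.Build
  (rV_display default_measure_display)
  'rV[R]_n (g_sigma_preimage rV_coord) rV_set0 rV_setC rV_bigcup.

Lemma measurable_rV_coord i : measurable_fun [set: 'rV[R]_n] (rV_coord i).
Proof.
move=> _ Y mY; rewrite setTI; apply: sub_sigma_algebra => /=.
rewrite -bigcup_seq/=; exists i => /=; first by rewrite mem_index_enum.
by exists Y => //; rewrite setTI.
Qed.

Lemma measurable_fun_rV d (T : measurableType d) (f : T -> 'rV[R]_n) :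
  (forall i, measurable_fun [set: T] (rV_coord i \o f)) ->
  measurable_fun [set: T] f.
Proof.
move=> mf _ A mA; rewrite setTI.
suff : g_sigma_preimage rV_coord `<=` [set A | measurable (f @^-1` A)] by exact.
apply: smallest_sub.
  split=> /= [|B mB|F mF]; first by rewrite preimage_set0.
    by rewrite setTD preimage_setC; exact: measurableC.
  by rewrite preimage_bigcup; exact: bigcup_measurable.
move=> B; rewrite -bigcup_seq/= => -[i _ [C mC <-]] /=.
by rewrite setTI; have := mf i measurableT C mC; rewrite setTI.
Qed.

End measurable_rV.

Section lebesgue_rV_step.
Context {R : realType} (n : nat)
  (mu : {sigma_finite_measure set 'rV[R]_n -> \bar R}).

Definition cons_rV (p : measurableTypeR R * 'rV[R]_n) : 'rV[R]_n.+1 :=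
  row_mx (p.1 : R)%:M p.2.

Lemma hd_cons_rV t y : cons_rV (t, y) 0 ord0 = t.
Proof.
rewrite /cons_rV /=; have -> : ord0 = lshift n (@ord0 0) by exact/val_inj.
by rewrite (row_mxEl (t : R)%:M y ord0 ord0) mxE.
Qed.

Lemma tl_cons_rV t y i : cons_rV (t, y) 0 (lift ord0 i) = y 0 i.
Proof.
rewrite /cons_rV /=; have -> : lift ord0 i = rshift 1 i by exact/val_inj.
by rewrite (row_mxEr (t : R)%:M y ord0 i).
Qed.

Lemma measurable_cons_rV : measurable_fun setT cons_rV.
Proof.
apply: measurable_fun_rV => i; case: (unliftP ord0 i) => [j ->|->].
  rewrite (_ : _ \o _ = rV_coord j \o snd).
    exact: measurableT_comp (measurable_rV_coord j) measurable_snd.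
  by apply/funext => -[t y]; rewrite /rV_coord /= tl_cons_rV.
rewrite (_ : _ \o _ = fst) //.
by apply/funext => -[t y]; rewrite /rV_coord /= hd_cons_rV.
Qed.

Definition lebesgue_rV_succ : set 'rV[R]_n.+1 -> \bar R :=
  pushforward (lebesgue_measure \x mu)%E cons_rV.

Local Open Scope ereal_scope.

Let prod_mu : {measure set (measurableTypeR R * 'rV[R]_n) -> \bar R} :=
  (lebesgue_measure \x mu).

Let succ0 : lebesgue_rV_succ set0 = 0.
Proof.
by rewrite /lebesgue_rV_succ /pushforward preimage_set0 (measure0 prod_mu).
Qed.

Let succ_ge0 A : 0 <= lebesgue_rV_succ A.
Proof. exact: (measure_ge0 prod_mu). Qed.

Let succ_sigma_additive : semi_sigma_additive lebesgue_rV_succ.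
Proof.
move=> F mF tF mUF; rewrite /lebesgue_rV_succ /pushforward preimage_bigcup.
have mc A : measurable A -> measurable (cons_rV @^-1` A).
  by move=> mA; rewrite -[X in measurable X]setTI; exact: measurable_cons_rV.
apply: (@measure_semi_sigma_additive _ _ _ prod_mu).
- by move=> k; exact: mc.
- apply/trivIsetP => /= i j _ _ ij; rewrite -preimage_setI.
  by move/trivIsetP : tF => /(_ _ _ _ _ ij) ->//; rewrite preimage_set0.
- by rewrite -preimage_bigcup; exact: mc.
Qed.

HB.instance Definition _ := isMeasure.Build _ _ _ lebesgue_rV_succ
  succ0 succ_ge0 succ_sigma_additive.

Let succ_sigma_finite : sigma_finite setT lebesgue_rV_succ.
Proof.
have [F FT mF] := sigma_finiteT (@lebesgue_measure R).
have [G GT mG] := sigma_finiteT mu.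
pose hd (x : 'rV[R]_n.+1) : measurableTypeR R := rV_coord ord0 x.
pose tl (x : 'rV[R]_n.+1) : 'rV[R]_n := \row_i x ord0 (lift ord0 i).
have mtl : measurable_fun setT tl.
  apply: measurable_fun_rV => i.
  rewrite (_ : _ \o _ = rV_coord (lift ord0 i)).
    exact: measurable_rV_coord.
  by apply/funext => x; rewrite /rV_coord /tl /= mxE.
have mhd : measurable_fun setT hd by exact: measurable_rV_coord.
have tlE t y : tl (cons_rV (t, y)) = y.
  by apply/rowP => i; rewrite mxE tl_cons_rV.
have consE A B : cons_rV @^-1` (hd @^-1` A `&` tl @^-1` B) = A `*` B.
  by apply/seteqP; split => -[t y] /=; rewrite /hd /rV_coord hd_cons_rV tlE.
have [h hbij] : exists h : nat -> nat * nat, forall p, exists k, h k = p.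
  exists (fun k => odflt (0, 0)%N (unpickle k)) => p.
  by exists (pickle p); rewrite pickleK.
exists (fun k => hd @^-1` (F (h k).1) `&` tl @^-1` (G (h k).2)).
  apply/esym/seteqP; split => // x _.
  have [i _ Fi] : (\bigcup_i F i) (hd x) by rewrite -FT.
  have [j _ Gj] : (\bigcup_i G i) (tl x) by rewrite -GT.
  by have [k hk] := hbij (i, j); exists k => //=; rewrite hk.
move=> k; have [mFk Fkoo] := mF (h k).1; have [mGk Gkoo] := mG (h k).2.
split.
  apply: measurableI.
    by rewrite -[X in measurable X]setTI; exact: mhd.
  by rewrite -[X in measurable X]setTI; exact: mtl.
rewrite /lebesgue_rV_succ /pushforward consE product_measure1E//.
by rewrite lte_mul_pinfty// ge0_fin_numE.
Qed.

HB.instance Definition _ := Measure_isSigmaFinite.Build _ _ _ lebesgue_rV_succ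
  succ_sigma_finite.

End lebesgue_rV_step.

Fixpoint lebesgue_rV {R : realType} (n : nat) :
    {sigma_finite_measure set 'rV[R]_n -> \bar R} :=
  match n with
  | 0 => dirac (0 : 'rV[R]_0)
  | m.+1 => lebesgue_rV_succ (lebesgue_rV m)
  end.

Lemma lebesgue_rV_box {R : realType} (n : nat)
    (A : 'I_n -> set (measurableTypeR R)) :
  (forall i, measurable (A i)) ->
  lebesgue_rV n [set x : 'rV[R]_n | forall i, A i (x 0 i)] =
  (\prod_(i < n) lebesgue_measure (A i))%E.
Proof.
elim: n A => [|n IH] A mA.
  by rewrite big_ord0 /= diracE mem_set// => -[].
rewrite big_ord_recl -IH//= /lebesgue_rV_succ /pushforward.
rewrite -(@product_measure1E _ _ _ _ _ lebesgue_measure (lebesgue_rV n))//.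
  congr (_ _); apply/seteqP; split => -[t y] /=.
    move=> H; split; first by have := H ord0; rewrite hd_cons_rV.
    by move=> i; have := H (lift ord0 i); rewrite tl_cons_rV.
  move=> [At Ay] i; case: (unliftP ord0 i) => [j ->|->].
    by rewrite tl_cons_rV.
  by rewrite hd_cons_rV.
rewrite (_ : mkset _ = \bigcap_(i in [set: 'I_n])
    (rV_coord i @^-1` A (lift ord0 i))).
  apply: fin_bigcap_measurable => // i _.
  by rewrite -[X in measurable X]setTI; exact: measurable_rV_coord.
by apply/seteqP; split => x /= H i; [move=> _; exact: H|exact: (H i I)].
Qed.

Section euclidean.
Context {R : realType} {n : nat}.
Implicit Types (x y : 'rV[R]_n) (O : set 'rV[R]_n) (u : 'rV[R]_n -> R).

(* The library norm on row vectors is the sup norm; it induces the same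
   topology, but balls and distances here must be Euclidean. *)
Definition enorm x : R := Num.sqrt (\sum_(i < n) x 0 i ^+ 2).

Definition eball x (r : R) : set 'rV[R]_n := [set y | enorm (y - x) < r].

Definition bd O : set 'rV[R]_n := closure O `\` interior O.

Definition bdist O x : R := inf [set enorm (x - y) | y in bd O].

(* [c] is the normalization constant; [is_frac_laplacian c s u x l] says that
   the principal value at [x] exists and that [(-Delta)^s u(x) = l]. *)
Definition is_frac_laplacian (c s : R) u x (l : R) : Prop :=
  (fun e : R => c%:E * \int[lebesgue_rV n]_(y in [set y | (e < enorm y)%R])
      ((u x - u (x + y)) / enorm y `^ (n%:R + 2 * s))%:E)%E
    @ 0^'+ --> l%:E.

(* C^s(O), as local Hoelder continuity; a uniform Hoelder bound on O implies it. *)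
Definition holder_loc (s : R) O u : Prop :=
  forall K : set 'rV[R]_n, compact K -> K `<=` O ->
  exists C : R, forall x y, K x -> K y -> `|u x - u y| <= C * enorm (x - y) `^ s.

(* For L^infinity: a bounded representative, as the equation is imposed at every
   point of the domain. *)
Definition bounded_on O u : Prop := exists M : R, forall x, O x -> `|u x| <= M.

(* Touching balls B_r(xr r); the sphere of centre [xr r] and radius [r] passes
   through [x0]. *)
Definition interior_balls O x0 (rbar : R) (xr : R -> 'rV[R]_n) : Prop :=
  0 < rbar /\ forall r, 0 < r <= rbar ->
    eball (xr r) r `<=` O /\ enorm (x0 - xr r) = r.

Definition Phi (s : R) u (xr : R -> 'rV[R]_n) (r : R) : R :=
  inf [set `|u y| | y in eball (xr r) (r / 2)] / r `^ (2 * s).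

Definition grows_faster_2s (s : R) u x0 (xr : R -> 'rV[R]_n) : Prop :=
  [/\ continuous u, u x0 = 0,
      \forall r \near 0^'+, forall y, eball (xr r) r y -> 0 < `|u y| &
      limf_esup (fun r : R => (Phi s u xr r)%:E) 0^'+ = +oo%E].

Definition continuous_extension O (f g : 'rV[R]_n -> R) : Prop :=
  {within closure O, continuous g} /\ forall x, O x -> g x = f x.

Definition C11_function (g : 'rV[R]_n -> R) : Prop :=
  (forall x, differentiable g x) /\
  exists K : R, forall x y v, `|'d g x v - 'd g y v| <= K * `|x - y| * `|v|.

End euclidean.

(* Near each boundary point, after the orthogonal change of coordinates [Q],
   the set is the strict epigraph, in the first coordinate, of a C^{1,1}
   function of the remaining [n] coordinates. *)
Definition C11_open {R : realType} {n : nat} (O : set 'rV[R]_n.+1) : Prop :=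
  open O /\
  forall x, bd O x -> exists (r : R) (Q : 'M[R]_n.+1) (g : 'rV[R]_n -> R),
    [/\ 0 < r, Q *m Q^T = 1%:M, C11_function g &
        forall y, eball x r y ->
          (O y <-> g (\row_i (y *m Q) 0 (lift ord0 i)) < (y *m Q) 0 0)].

(* Main.v *)
(* A barrier in the interior balls reduces the claim to a one-dimensional estimate.

   Assume u > 0 near x0 (otherwise take -u). Let B_r(p) be a small interior ball
   touching the boundary at x0, let m be the infimum of |u| over B_{r/2}(p) and
   let b(y) = (r^2 - |y - p|^2)_+^s. At a point x where v = u - eps m r^(-2s) b is
   negative and minimal over the closed ball, x lies in the annulus outside
   B_{r/2}(p), and comparing v(x) with v(x + y) bounds (-Delta)^s u(x) above by
   C - c0 m r^(-2s): the mass near the centre contributes a multiple of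
   -m r^(-2s), the points far away, where u may be negative, contribute a
   constant, and (-Delta)^s b is bounded. The equation bounds (-Delta)^s u(x)
   below, so no such x exists once m / r^(2s) is large, which the growth condition
   provides for some r. Hence u >= const * b in B_r(p), and b is comparable to d^s
   along the segment from x0 to p.

   The upper bound for (-Delta)^s b, uniform in the truncation of the singular
   integral, is obtained by slicing along the lines through x, on which b is the
   power s of the positive part of a concave quadratic. A quadratic is compared
   with its linear part t |-> a + b t; for the latter, the change of variables
   t |-> t / (1 - g t) on one half-line matches the two half-lines, the sum of the
   integrands then having the primitive -t^(-2s) (1 - g t)^s / s. *)
From HB Require Import structures.
Require Import Defs.
From mathcomp Require Import all_boot all_order all_algebra.
From mathcomp Require Import all_classical all_reals all_analysis.
From mathcomp Require Import measurable_realfun.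
From mathcomp Require Import ring lra.
Set Implicit Arguments.
Unset Strict Implicit.
Unset Printing Implicit Defensive.
Import Order.TTheory GRing.Theory Num.Theory.
Import numFieldNormedType.Exports.
Local Open Scope classical_set_scope.
Local Open Scope ring_scope.

(** * One-dimensional estimates *)

Lemma is_derive_continuous (R : realType) (F : R -> R) (x dF : R) :
  is_derive x 1 F dF -> {for x, continuous F}.
Proof. by move=> [dFx _]; apply/differentiable_continuous/derivable1_diffP. Qed.

Lemma is_derive_powR (R : realType) (p x : R) : 0 < x ->
  is_derive x 1 (fun t : R => t `^ p) (p * x `^ (p - 1)).
Proof.
move=> x0; have xi : x \in `]0, +oo[ by rewrite in_itv /= x0.
have dx : derivable (fun t : R => t `^ p) x 1 by exact: derivable_powR.
have := powR_derive1 p xi; rewrite derive1E => <-.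
exact: DeriveDef.
Qed.

Lemma continuous_powR_pos (R : realType) (p x : R) : 0 < x ->
  {for x, continuous (fun t : R => t `^ p)}.
Proof. by move=> x0; exact: is_derive_continuous (is_derive_powR p x0). Qed.

Lemma derivable_oo_LR_is_derive (R : realType) (F f : R -> R) (a b : R) : a < b ->
  (forall t, a <= t <= b -> is_derive t 1 F (f t)) ->
  derivable_oo_LRcontinuous F a b.
Proof.
move=> ab dF; split.
- move=> t; rewrite in_itv /= => /andP[/ltW a_t /ltW t_b].
  by have [] : is_derive t 1 F (f t) by apply: dF; rewrite a_t t_b.
- apply: cvg_at_right_filter; apply: (@is_derive_continuous _ _ _ (f a)).
  by apply: dF; rewrite lexx ltW.
- apply: cvg_at_left_filter; apply: (@is_derive_continuous _ _ _ (f b)).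
  by apply: dF; rewrite lexx ltW.
Qed.

Lemma within_itvcc_continuous (R : realType) (f : R -> R) (a b : R) :
  (forall t, a <= t <= b -> {for t, continuous f}) ->
  {within `[a, b], continuous f}.
Proof.
move=> cf; apply: continuous_in_subspaceT => t; rewrite inE /= in_itv /=.
exact: cf.
Qed.

Lemma integral_is_derive (R : realType) (F f : R -> R) (a b : R) : a < b ->
  (forall t, a <= t <= b -> is_derive t 1 F (f t)) ->
  (forall t, a <= t <= b -> {for t, continuous f}) ->
  (\int[lebesgue_measure]_(x in `[a, b]) (f x)%:E = (F b)%:E - (F a)%:E)%E.
Proof.
move=> ab dF cf; apply: continuous_FTC2 => //.
- exact: within_itvcc_continuous.
- exact: derivable_oo_LR_is_derive dF.
- move=> t; rewrite in_itv /= => /andP[/ltW a_t /ltW t_b].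
  by rewrite derive1E; apply/derive_val/dF; rewrite a_t t_b.
Qed.

(** The derivative formula is assumed on the larger open interval []c, d[]: near each point of
    [[a, b]], endpoints included, [derive1 F] then agrees with [f] and inherits its continuity. *)
Lemma integral_subst_is_derive (R : realType) (F f G : R -> R) (c d a b : R) :
  c < a -> a < b -> b < d ->
  (forall t, c < t < d -> is_derive t 1 F (f t)) ->
  (forall t, a <= t <= b -> {for t, continuous f}) ->
  {in `[a, b] &, {homo F : x y / x < y}} ->
  (forall t, F a <= t <= F b -> {for t, continuous G}) ->
  (\int[lebesgue_measure]_(x in `[F a, F b]) (G x)%:E =
   \int[lebesgue_measure]_(x in `[a, b]) (G (F x) * f x)%:E)%E.
Proof.
move=> ca ab bd dF cf Fmono cG.
have F'E t : c < t < d -> derive1 F t = f t.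
  by move=> ctd; rewrite derive1E; apply/derive_val/dF.
have cF' t : a <= t <= b -> {for t, continuous (derive1 F)}.
  move=> /andP[a_t t_b]; have /cf h : a <= t <= b by rewrite a_t t_b.
  have ct : c < t < d by rewrite (lt_le_trans ca)// (le_lt_trans t_b).
  rewrite /prop_for /continuous_at F'E//.
  apply: cvg_trans h; apply: near_eq_cvg.
  near=> u; apply/esym/F'E; near: u.
  have : t \in `]c, d[ by rewrite in_itv.
  by move/near_in_itvoo; apply: filterS => u; rewrite in_itv.
rewrite integration_by_substitution_increasing//.
- apply: eq_integral => x; rewrite inE /= in_itv /= => /andP[ax xb].
  congr (G (F x) * _)%:E; apply: F'E.
  by rewrite (lt_le_trans ca)// (le_lt_trans xb).
- exact: ltW.
- by move=> t; rewrite in_itv /= => /andP[/ltW ? /ltW ?]; apply: cF'; apply/andP.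
- apply/cvg_ex; exists (derive1 F a); apply: cvg_at_right_filter.
  by apply: cF'; rewrite lexx ltW.
- apply/cvg_ex; exists (derive1 F b); apply: cvg_at_left_filter.
  by apply: cF'; rewrite lexx ltW.
- apply: (@derivable_oo_LR_is_derive _ _ f) => // t /andP[a_t t_b]; apply: dF.
  by rewrite (lt_le_trans ca)// (le_lt_trans t_b).
- exact: within_itvcc_continuous.
Unshelve. all: by end_near. Qed.

Lemma le_powRl (R : realType) (p x y : R) : 0 <= p -> 0 <= x -> x <= y ->
  x `^ p <= y `^ p.
Proof.
by move=> p0 x0 xy; apply: ge0_ler_powR => //; rewrite nnegrE// (le_trans x0).
Qed.

Lemma le_powRN (R : realType) (p x y : R) : 0 <= p -> 0 < x -> x <= y ->
  y `^ (- p) <= x `^ (- p).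
Proof.
move=> p0 x0 xy; rewrite !powRN lef_pV2 ?posrE ?powR_gt0 ?(lt_le_trans x0)//.
by apply: le_powRl => //; exact: ltW.
Qed.

Lemma powR_ge1 (R : realType) (p x : R) : 0 <= p -> 1 <= x -> 1 <= x `^ p.
Proof.
by move=> p0 x1; have := le_powRl p0 ler01 x1; rewrite powR1.
Qed.

Lemma powR_le1 (R : realType) (p x : R) : 0 <= p -> 0 <= x -> x <= 1 -> x `^ p <= 1.
Proof.
by move=> p0 x0 x1; have := le_powRl p0 x0 x1; rewrite powR1.
Qed.

Lemma mulr_powR (R : realType) (x p : R) : 0 < x -> x * x `^ p = x `^ (p + 1).
Proof.
by move=> x0; rewrite powRD ?(gt_eqF x0) ?implybT// powRr1 ?ltW// mulrC.
Qed.

Lemma integral_powR_itv (R : realType) (p a b : R) : p != 0 -> 0 < a -> a < b ->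
  (\int[lebesgue_measure]_(x in `[a, b]) (x `^ (p - 1))%:E =
   ((b `^ p - a `^ p) / p)%:E)%E.
Proof.
move=> p0 a0 ab.
pose F (x : R) := p^-1 * x `^ p.
have dF t : a <= t <= b -> is_derive t 1 F (t `^ (p - 1)).
  move=> /andP[a_t _]; have t0 : 0 < t by exact: lt_le_trans a_t.
  have := is_deriveZ p^-1 (is_derive_powR p t0).
  by rewrite /GRing.scale /= mulrA mulVf// mul1r.
rewrite (integral_is_derive ab dF) /F; first by rewrite -EFinB -mulrBr mulrC.
by move=> t /andP[a_t _]; apply: continuous_powR_pos; exact: lt_le_trans a_t.
Qed.

Lemma powRN_cvgy (R : realType) (p : R) : 0 < p -> x `^ (- p) @[x --> +oo%R] --> (0 : R).
Proof.
move=> p0.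
apply/cvgrPdist_lt => e e0; near=> x.
have x0 : 0 < x by near: x; apply: nbhs_pinfty_gt; exact: num_real.
rewrite sub0r normrN ger0_norm ?powR_ge0//.
have ex : e `^ (- p^-1) < x.
  by near: x; apply: nbhs_pinfty_gt; exact: num_real.
have -> : e = (e `^ (- p^-1)) `^ (- p).
  by rewrite -powRrM mulrNN mulVf ?gt_eqF// powRr1// ltW.
rewrite (powRN x) (powRN (e `^ _)) ltf_pV2 ?posrE ?powR_gt0//.
by apply: gt0_ltr_powR => //; rewrite nnegrE ?powR_ge0// ltW.
Unshelve. all: by end_near. Qed.

Lemma integral_powR_tail (R : realType) (p a : R) : 0 < p -> 0 < a ->
  (\int[lebesgue_measure]_(x in `[a, +oo[) (x `^ (- (1 + p)))%:E =
   (a `^ (- p) / p)%:E)%E.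
Proof.
move=> p0 a0.
have dF (x : R) : 0 < x -> is_derive x 1 (fun x : R => - p^-1 * x `^ (- p)) (x `^ (- (1 + p))).
  move=> x0; have := is_deriveZ (- p^-1) (is_derive_powR (- p) x0).
  by rewrite /GRing.scale /= mulrA mulrNN mulVf ?gt_eqF// mul1r opprD addrC.
rewrite (@ge0_continuous_FTC2y _ _ (fun x => - p^-1 * x `^ (- p)) a 0).
- by rewrite sub0e -EFinN mulNr opprK mulrC.
- by move=> x _; exact: powR_ge0.
- apply: continuous_in_subspaceT => x; rewrite inE /= in_itv /= andbT => ax.
  by apply: continuous_powR_pos; exact: lt_le_trans ax.
- rewrite -[X in _ --> X](mulr0 (- p^-1)).
  by apply: cvgMr; exact: powRN_cvgy.
- by move=> x ax; have [] := dF _ (lt_trans a0 ax).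
- by apply: cvg_at_right_filter; exact: is_derive_continuous (dF _ a0).
- move=> x; rewrite in_itv /= andbT => ax.
  by rewrite derive1E; exact/derive_val/dF/(lt_trans a0 ax).
Qed.

(** * The profile 1 + g t on two opposite half-lines *)

Section halfline.
Context {R : realType} (s g : R).
Hypotheses (s0 : 0 < s) (s1 : s <= 1) (g0 : 0 < g).

Let D (t : R) := 1 - g * t.

Let is_derive_D (t : R) : is_derive t 1 D (- g).
Proof.
have := is_deriveB (is_derive_cst (1 : R) t 1) (is_deriveZ g (is_derive_id t (1:R))).
by rewrite /GRing.scale /= mulr1 sub0r.
Qed.

Let dDpow (p t : R) : 0 < D t ->
  is_derive t 1 (fun t => D t `^ p) (- g * (p * D t `^ (p - 1))).
Proof.
move=> Dt; have := is_derive1_comp (is_derive_powR p Dt) (is_derive_D t).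
by rewrite mulrC.
Qed.

(* Primitive of the sum of [w t * D t `^ s] and of the integrand
   [w t * (1 + g * t) `^ s] transported by [fold] below. *)
Let fold_prim (t : R) := - s^-1 * (t `^ (- (2 * s)) * D t `^ s).

Let is_derive_fold_prim (t : R) : 0 < t -> 0 < D t ->
  is_derive t 1 fold_prim
    (t `^ (- (1 + 2 * s)) * (D t `^ s + D t `^ (s - 1))).
Proof.
move=> t0 Dt.
have := is_deriveZ (- s^-1) (is_deriveM (is_derive_powR (- (2 * s)) t0) (dDpow s Dt)).
congr (is_derive _ _ _ _).
rewrite /GRing.scale /=.
have -> : t `^ (- (2 * s)) = t * t `^ (- (1 + 2 * s)).
  by rewrite mulr_powR//; congr (_ `^ _); ring.
have -> : D t `^ s = D t * D t `^ (s - 1) by rewrite mulr_powR// subrK.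
have -> : - (2 * s) - 1 = - (1 + 2 * s) by ring.
rewrite {1 2 4}/D; field; exact: lt0r_neq0.
Qed.

Let w (t : R) := t `^ (- (1 + 2 * s)).

(** An increasing map of the interval from 0 to 1/g onto the positive half-line with
    [1 + g * fold t = 1 / D t]: the growing profile on one half-line becomes a power of the
    decreasing profile on the other. *)
Let fold (t : R) := t / D t.

Let is_derive_fold (t : R) : 0 < D t -> is_derive t 1 fold (D t `^ (- 2)).
Proof.
move=> Dt.
have := is_deriveM (is_derive_id t (1:R)) (is_deriveV (lt0r_neq0 Dt) (is_derive_D t)).
congr (is_derive _ _ _ _).
rewrite /GRing.scale /= mulr1 powR_invn ?ltW// /D.
by field; exact: lt0r_neq0.
Qed.

Let fold_integrand (t : R) : 0 < t -> 0 < D t ->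
  (1 + g * fold t) `^ s * w (fold t) * D t `^ (- 2) = w t * D t `^ (s - 1).
Proof.
move=> t0 Dt; have Dt0 := ltW Dt.
have -> : 1 + g * fold t = D t `^ (- 1).
  by rewrite powR_inv1// /fold /D; field; exact: lt0r_neq0.
rewrite /w /fold powRM ?ltW ?invr_gt0// -(powR_inv1 Dt0) -!powRrM.
rewrite mulrCA -!mulrA; congr (_ * _).
rewrite -!powRD ?(gt_eqF Dt) ?implybT//.
by congr (_ `^ _); ring.
Qed.

(** The second interval is the image of [[e, om]] under [fold]. After substitution both integrals
    run over [[e, om]], and [fold_prim] is a primitive of the sum of the integrands. *)
Lemma halfline_fold (e om : R) : 0 < e -> e < om -> g * om < 1 ->
  (\int[lebesgue_measure]_(t in `[e, om]) (w t * (1 - g * t) `^ s)%:E +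
   \int[lebesgue_measure]_(t in `[(e / (1 - g * e))%R, (om / (1 - g * om))%R])
     ((1 + g * t) `^ s * w t)%:E =
   (s^-1 * (e `^ (- (2 * s)) * (1 - g * e) `^ s)
    - s^-1 * (om `^ (- (2 * s)) * (1 - g * om) `^ s))%:E)%E.
Proof.
move=> e0 eom gom.
have Dpos t : t <= om -> 0 < D t.
  by move=> tom; rewrite subr_gt0 (le_lt_trans _ gom)// ler_wpM2l// ltW.
have cD (p t : R) : 0 < D t -> {for t, continuous (fun t => D t `^ p)}.
  by move=> Dt; exact: is_derive_continuous (dDpow p Dt).
have cw (t : R) : 0 < t -> {for t, continuous w} by exact: continuous_powR_pos.
have om1 : om < g^-1 by rewrite -(ltr_pM2l g0) mulfV// lt0r_neq0.
have cG t : fold e <= t -> {for t, continuous (fun t => (1 + g * t) `^ s * w t)}.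
  move=> et; have t0 : 0 < t.
    by rewrite (lt_le_trans _ et)// divr_gt0// Dpos// ltW.
  have gt0 : 0 < 1 + g * t by rewrite ltr_wpDr// ?mulr_ge0// ltW.
  have h : is_derive t 1 (fun t => 1 + g * t) g.
    have := is_deriveD (is_derive_cst (1 : R) t 1) (is_deriveZ g (is_derive_id t (1:R))).
    by rewrite /GRing.scale /= mulr1 add0r.
  apply: continuousM; last exact: cw.
  have h2 := @is_derive1_comp R (fun u => u `^ s) (fun t => 1 + g * t) t _ _ (is_derive_powR s gt0) h.
  exact: (is_derive_continuous h2).
have dfold t : 0 < t < g^-1 -> is_derive t 1 fold (D t `^ (- 2)).
  move=> /andP[t0 tg]; apply: is_derive_fold.
  by rewrite subr_gt0 -(@mulfV _ g) ?lt0r_neq0// ltr_pM2l.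
have cfold t : e <= t <= om -> {for t, continuous (fun t => D t `^ (- 2))}.
  by move=> /andP[_ tom]; apply: cD; exact: Dpos.
have fold_incr : {in `[e, om] &, {homo fold : x y / x < y}}.
  move=> x y; rewrite !in_itv /= => /andP[ex xo] /andP[ey yo] xy.
  rewrite /fold ltr_pdivrMr ?Dpos// mulrAC ltr_pdivlMr ?Dpos// /D.
  by rewrite !mulrBr !mulr1 [y * (g * x)]mulrCA [x * (g * y)]mulrCA [y * x]mulrC ltrD2r.
have cG' t : fold e <= t <= fold om ->
    {for t, continuous (fun t => (1 + g * t) `^ s * w t)}.
  by move=> /andP[et _]; exact: cG.
rewrite (integral_subst_is_derive e0 eom om1 dfold cfold fold_incr cG').
under [X in (_ + X)%E]eq_integral => t.
  rewrite inE /= in_itv /= => /andP[et tom].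
  rewrite fold_integrand ?Dpos// ?(lt_le_trans e0 et)//.
  over.
have dF t : e <= t <= om -> is_derive t 1 fold_prim (w t * (D t `^ s + D t `^ (s - 1))).
  move=> /andP[et tom]; apply: is_derive_fold_prim; last exact: Dpos.
  exact: lt_le_trans et.
have cA p : {within `[e, om], continuous (fun t => w t * D t `^ p)}.
  apply: within_itvcc_continuous => t /andP[et tom]; apply: continuousM.
    by apply: cw; exact: lt_le_trans et.
  by apply: cD; exact: Dpos.
have cF t : e <= t <= om -> {for t, continuous (fun t => w t * (D t `^ s + D t `^ (s - 1)))}.
  move=> /andP[et tom]; apply: continuousM.
    by apply: cw; exact: lt_le_trans et.
  by apply: continuousD; apply: cD; exact: Dpos.
have iA p : lebesgue_measure.-integrable `[e, om] (EFin \o (fun t => w t * D t `^ p)).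
  by apply: continuous_compact_integrable => //; exact: segment_compact.
transitivity (\int[lebesgue_measure]_(t in `[e, om])
    (w t * (D t `^ s + D t `^ (s - 1)))%:E)%E.
  under [RHS]eq_integral do rewrite mulrDr EFinD.
  by rewrite integralD//=; [exact: iA|exact: iA].
rewrite (integral_is_derive eom dF cF) -EFinB; congr (_%:E).
by rewrite /fold_prim /D; ring.
Qed.

Lemma measurable_halfline_weight (b : R) :
  measurable_fun [set: R] (fun t => Num.max 0 (1 + b * t) `^ s * t `^ (- (1 + 2 * s))).
Proof.
apply: measurable_funM; last exact: measurable_powR.
apply: (measurableT_comp (measurable_powR s)).
apply: measurable_maxr => //; exact: measurable_funD.
Qed.

(** The left side is twice the integral of [t^(-(1 + 2s))] over [[e, +oo[], so this is a truncated,
    one-sided form of the fact that the power s of the positive part of a linear function has zero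
    fractional Laplacian where it is positive. The error is of order [e^(2 - 2s)]. It arises because
    [fold] does not fix [e], so that the two half-lines are cut at different points. *)
Lemma halfline_lower_bound (e : R) : 0 < e -> g * e < 1 ->
  ((s^-1 * e `^ (- (2 * s)))%:E <=
   \int[lebesgue_measure]_(t in `[e, +oo[)
     ((Num.max 0 (1 + g * t) `^ s + Num.max 0 (1 - g * t) `^ s)
        * t `^ (- (1 + 2 * s)))%:E
   + ((g * e) ^+ 2 * e `^ (- (2 * s)) / (2 * s))%:E)%E.
Proof.
move=> e0 ge1; apply/lee_addgt0Pr => eps eps0.
(* Folding stops at [om], just before the zero 1/g of the decreasing profile, with [1 - g * om = d].
   The first bound on [d] ensures [e < om]; the second makes the boundary term at [om] at most
   [eps]. *)
pose d := Num.min ((1 - g * e) / 2) ((eps * s * e `^ (2 * s)) `^ s^-1).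
have ge0 : 0 < 1 - g * e by rewrite subr_gt0.
have c0 : 0 < eps * s * e `^ (2 * s) by rewrite !mulr_gt0// powR_gt0.
have d0 : 0 < d by rewrite lt_min divr_gt0//= powR_gt0.
have dle : d <= (1 - g * e) / 2 by rewrite ge_min lexx.
pose om := (1 - d) / g.
have gomE : 1 - g * om = d by rewrite /om; field; exact: lt0r_neq0.
have eom : e < om by rewrite /om ltr_pdivlMr// [e * g]mulrC; lra.
have gom : g * om < 1 by lra.
have om0 := lt_trans e0 eom.
have err : s^-1 * (om `^ (- (2 * s)) * (1 - g * om) `^ s) <= eps.
  rewrite gomE ler_pdivrMl// mulrC.
  apply: (@le_trans _ _ (eps * s * e `^ (2 * s) * e `^ (- (2 * s)))); last first.
    by rewrite powRN -mulrA mulfV ?mulr1 1?mulrC// gt_eqF// powR_gt0.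
  rewrite ler_pM ?powR_ge0//.
    apply: (@le_trans _ _ (((eps * s * e `^ (2 * s)) `^ s^-1) `^ s)).
      apply: le_powRl; [exact: ltW|exact: ltW|].
      by rewrite /d ge_min lexx orbT.
    by rewrite -powRrM mulVf ?gt_eqF// powRr1// ltW.
  by apply: le_powRN => //; [rewrite mulr_ge0// ltW|exact: ltW].
pose e' := e / (1 - g * e); pose om' := om / (1 - g * om).
have de1 : 1 - g * e < 1 by rewrite ltrBlDr ltrDl mulr_gt0.
have ee' : e < e' by rewrite /e' ltr_pdivlMr// gtr_pMr.
have e'om' : e' < om'.
  rewrite /e' /om' gomE ltr_pdivrMr// mulrAC ltr_pdivlMr//.
  rewrite (@lt_trans _ _ (e * (1 - g * e)))// ?ltr_pM2l//; last by rewrite ltr_pM2r.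
  lra.
have e'0 := lt_trans e0 ee'.
pose A t := Num.max 0 (1 + g * t) `^ s * t `^ (- (1 + 2 * s)).
pose B t := Num.max 0 (1 - g * t) `^ s * t `^ (- (1 + 2 * s)).
have A0 t : 0 <= A t by rewrite mulr_ge0// powR_ge0.
have B0 t : 0 <= B t by rewrite mulr_ge0// powR_ge0.
have mA : measurable_fun [set: R] A by exact: measurable_halfline_weight.
have mB : measurable_fun [set: R] B.
  by rewrite /B; under eq_fun do rewrite -mulNr; exact: measurable_halfline_weight.
have mAE (X : set R) : measurable_fun X (EFin \o A).
  by apply/measurable_EFinP; exact: measurable_funTS.
have mBE (X : set R) : measurable_fun X (EFin \o B).
  by apply/measurable_EFinP; exact: measurable_funTS.
under eq_integral do rewrite mulrDl EFinD.
rewrite ge0_integralD//=; last 4 first.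
- by move=> t _; rewrite lee_fin; exact: A0.
- exact: mAE.
- by move=> t _; rewrite lee_fin; exact: B0.
- exact: mBE.
have IB : (\int[lebesgue_measure]_(t in `[e, om]) (t `^ (- (1 + 2 * s)) * (1 - g * t) `^ s)%:E
    <= \int[lebesgue_measure]_(t in `[e, +oo[) (B t)%:E)%E.
  rewrite (_ : integral _ _ _ = (\int[lebesgue_measure]_(t in `[e, om]) (B t)%:E)%E); last first.
    apply: eq_integral => t; rewrite inE /= in_itv /= => /andP[et tom].
    rewrite /B max_r; first by rewrite mulrC.
    rewrite subr_ge0 (le_trans _ (ltW gom))//.
    by rewrite ler_pM2l.
  apply: ge0_subset_integral => //=.
  - exact: mBE.
  - by move=> t _; rewrite lee_fin; exact: B0.
  - by move=> t; rewrite /= !in_itv /= andbT => /andP[].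
have IA2 : (\int[lebesgue_measure]_(t in `[e', om']) ((1 + g * t) `^ s * t `^ (- (1 + 2 * s)))%:E
    = \int[lebesgue_measure]_(t in `[e', om']) (A t)%:E)%E.
  apply: eq_integral => t; rewrite inE /= in_itv /= => /andP[et tom].
  by rewrite /A max_r// addr_ge0// mulr_ge0// ltW// (lt_le_trans e'0).
(* The interval from [e] to [e' = fold e] is not reached by the folding; there the growing profile
   is at least 1. *)
have IA1 : (((e `^ (- (2 * s)) - e' `^ (- (2 * s))) / (2 * s))%:E <=
    \int[lebesgue_measure]_(t in `[e, e'[) (A t)%:E)%E.
  rewrite integral_itv_bndo_bndc; last exact: mAE.
  have -> : (e `^ (- (2 * s)) - e' `^ (- (2 * s))) / (2 * s) =
      (e' `^ (- (2 * s)) - e `^ (- (2 * s))) / (- (2 * s)).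
    by field; exact: lt0r_neq0.
  have p0 : - (2 * s) != 0 by rewrite oppr_eq0; apply: lt0r_neq0; exact: mulr_gt0.
  rewrite -(integral_powR_itv p0 e0 ee').
  apply: ge0_le_integral.
  - exact: measurable_itv.
  - by move=> t _; rewrite lee_fin; exact: powR_ge0.
  - by apply/measurable_EFinP/measurable_funTS; exact: measurable_powR.
  - exact: mAE.
  - move=> t; rewrite /= in_itv /= => /andP[et te']; rewrite lee_fin /A.
    have t0 := lt_le_trans e0 et.
    have -> : - (2 * s) - 1 = - (1 + 2 * s) by ring.
    have gt0 : 0 <= g * t by apply: mulr_ge0; exact: ltW.
    rewrite max_r; last exact: addr_ge0.
    apply: ler_peMl; first exact: powR_ge0.
    by apply: powR_ge1; [exact: ltW|rewrite lerDl].
have IA : (\int[lebesgue_measure]_(t in `[e, e'[) (A t)%:E +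
     \int[lebesgue_measure]_(t in `[e', om']) (A t)%:E
    <= \int[lebesgue_measure]_(t in `[e, +oo[) (A t)%:E)%E.
  have dj : [disjoint `[e, e'[%classic & `[e', om']%classic].
    apply/disj_setPS => t [] /=; rewrite !in_itv /= => /andP[_ te'] /andP[e't _].
    by move: te'; rewrite ltNge e't.
  have AE0 (X : set R) t : X t -> (0 <= (EFin \o A) t)%E.
    by move=> _; rewrite lee_fin; exact: A0.
  have := @ge0_integral_setU _ _ _ lebesgue_measure `[e, e'[%classic
    `[e', om']%classic (measurable_itv _) (measurable_itv _) (EFin \o A) (mAE _) (AE0 _) dj.
  move=> <-; apply: ge0_subset_integral.
  - by apply: measurableU; exact: measurable_itv.
  - exact: measurable_itv.
  - exact: mAE.
  - exact: AE0.
  - move=> t; rewrite /= !in_itv /= andbT => -[] /andP[et _]; first exact: et.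
    exact: le_trans (ltW ee') et.
have foldE := halfline_fold e0 eom gom.
rewrite -/e' -/om' IA2 in foldE.
apply: (@le_trans _ _ ((((e `^ (- (2 * s)) - e' `^ (- (2 * s))) / (2 * s))%:E +
   (s^-1 * (e `^ (- (2 * s)) * (1 - g * e) `^ s)
    - s^-1 * (om `^ (- (2 * s)) * (1 - g * om) `^ s))%:E)
   + ((g * e) ^+ 2 * e `^ (- (2 * s)) / (2 * s))%:E + eps%:E)%E); last first.
  apply: leeD; last exact: lexx.
  apply: leeD; last exact: lexx.
  rewrite -foldE addeA addeAC; apply: (leeD _ IB).
  by apply: le_trans IA; apply: leeD; [exact: IA1|exact: lexx].
(* With [x = (1 - g e)^s] one has [e'^(-2s) = E x^2], so the gap and the boundary term at [e] add up
   to [E / s - E (1 - x)^2 / (2s)]. Since s is at most 1, [x] is at least [1 - g e], hence [1 - x]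
   is at most [g e]. *)
rewrite -!EFinD lee_fin.
set E := e `^ (- (2 * s)); set x := (1 - g * e) `^ s.
have E0 : 0 < E by exact: powR_gt0.
have -> : e' `^ (- (2 * s)) = E * x ^+ 2.
  have de0 : 0 <= (1 - g * e)^-1 by rewrite invr_ge0 ltW.
  rewrite /e' (powRM _ (ltW e0) de0); congr (_ * _).
  rewrite -(powR_inv1 (ltW ge0)) -(powRrM _ (-1)) mulrNN mul1r (mulrC 2) powRrM.
  exact: (powR_mulrn 2 (powR_ge0 _ _)).
have x1 : 1 - g * e <= x.
  apply: ger1_powR; last exact: s1.
  by rewrite ge0 /= ltW.
have x2 : x <= 1 by apply: powR_le1; exact: ltW.
move: x1; set y := g * e; move: x2 E0; move: x y E => {}x y E x2 E0 x1.
have key : (1 - x) ^+ 2 <= y ^+ 2 by rewrite ler_sqr ?nnegrE; lra.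
have : 0 <= E / (2 * s) * (y ^+ 2 - (1 - x) ^+ 2).
  by apply: mulr_ge0; [apply: divr_ge0; [exact: ltW|apply: mulr_ge0; [|exact: ltW]]|rewrite subr_ge0].
have -> : E / (2 * s) * (y ^+ 2 - (1 - x) ^+ 2) =
   (E - E * x ^+ 2) / (2 * s) + s^-1 * (E * x) + y ^+ 2 * E / (2 * s) - s^-1 * E.
  by field; exact: lt0r_neq0.
lra.
Qed.

End halfline.

(** * From linear to concave quadratic profiles *)

Lemma quadratic_pos_root (R : realType) (a b k : R) : 0 < a -> 0 < k ->
  exists2 T, 0 < T & a + b * T = k * T ^+ 2.
Proof.
move=> a0 k0; pose r := Num.sqrt (b ^+ 2 + 4 * a * k).
have ak : 0 < a * k by exact: mulr_gt0.
have b2 := sqr_ge0 b.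
have r2 : r ^+ 2 = b ^+ 2 + 4 * a * k.
  by rewrite sqr_sqrtr// addr_ge0// ?sqr_ge0// -mulrA mulr_ge0// ltW.
have br : `|b| < r by rewrite -sqrtr_sqr ltr_sqrt; lra.
have nb : - b <= `|b| by rewrite -normrN ler_norm.
exists ((b + r) / (2 * k)); first by rewrite divr_gt0 ?mulr_gt0//; lra.
have -> : k * ((b + r) / (2 * k)) ^+ 2 = (b ^+ 2 + 2 * b * r + r ^+ 2) / (4 * k).
  by field; exact: lt0r_neq0.
by rewrite r2; field; exact: lt0r_neq0.
Qed.

Section linear_vs_quadratic.
Context {R : realType} (s a b k T : R).
Hypotheses (s0 : 0 < s) (s1 : s < 1) (a0 : 0 < a) (k0 : 0 < k) (T0 : 0 < T).
Hypothesis rootT : a + b * T = k * T ^+ 2.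

Let lin (t : R) := Num.max 0 (a + b * t).
Let quad (t : R) := Num.max 0 (a + b * t - k * t ^+ 2).

(** The lines [a + b t] and [k T t] meet at the positive zero [T] of the quadratic: the first lies
    above the second before [T] and below it afterwards. This gives the power bounds on both sides
    of [T]. *)
Let linB_root t : (a + b * t) - k * T * t = a * (T - t) / T.
Proof.
have -> : b = (k * T ^+ 2 - a) / T by rewrite -rootT; field; exact: lt0r_neq0.
by field; exact: lt0r_neq0.
Qed.

(* [(1 - z) `^ s >= 1 - z] with [z = k t^2 / (a + b t)], and [a + b t >= k T t]. *)
Lemma lin_le_quad_below (t : R) : 0 < t -> t <= T ->
  lin t `^ s <= quad t `^ s + k * t ^+ 2 * (k * T * t) `^ (s - 1).
Proof.
move=> t0 tT; have h := linB_root t.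
have p0 : 0 <= a * (T - t) / T.
  by apply: divr_ge0; [apply: mulr_ge0; [exact: ltW|rewrite subr_ge0]|exact: ltW].
have kTt : 0 < k * T * t by rewrite !mulr_gt0.
have ktt : 0 < k * t ^+ 2 by rewrite mulr_gt0// exprn_gt0.
have L0 : 0 < a + b * t by lra.
have q0 : 0 <= a + b * t - k * t ^+ 2.
  have -> : a + b * t - k * t ^+ 2 = (a + b * t - k * T * t) + k * t * (T - t) by ring.
  rewrite h; apply: addr_ge0 => //.
  by apply: mulr_ge0; [apply/ltW/mulr_gt0|rewrite subr_ge0].
rewrite /lin /quad (max_r (ltW L0)) (max_r q0).
move: (a + b * t) L0 q0 h => L L0 q0 h.
have s'0 : 0 <= 1 - s by rewrite subr_ge0 ltW.
have Ls : L `^ s = L * L `^ (s - 1) by rewrite mulr_powR// subrK.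
have qs : (L - k * t ^+ 2) * L `^ (s - 1) <= (L - k * t ^+ 2) `^ s.
  move: q0; rewrite le_eqVlt => /orP[/eqP <-|q0].
    by rewrite mul0r powR_ge0.
  have -> : (L - k * t ^+ 2) `^ s = (L - k * t ^+ 2) * (L - k * t ^+ 2) `^ (s - 1).
    by rewrite mulr_powR// subrK.
  rewrite ler_pM2l// -(opprB 1 s); apply: le_powRN => //.
  by rewrite lerBlDr lerDl ltW.
have m : L `^ (s - 1) <= (k * T * t) `^ (s - 1).
  by rewrite -(opprB 1 s); apply: le_powRN => //; rewrite -subr_ge0 h.
rewrite Ls; apply: le_trans (lerD qs (ler_wpM2l (ltW ktt) m)).
by rewrite -mulrDl subrK.
Qed.

Lemma lin_le_quad_above (t : R) : T <= t -> lin t `^ s <= (k * T * t) `^ s.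
Proof.
move=> Tt; have h := linB_root t; have t0 := lt_le_trans T0 Tt.
have p0 : a * (T - t) / T <= 0.
  by rewrite pmulr_lle0 ?invr_gt0// pmulr_rle0// subr_le0.
apply: le_powRl; [exact: ltW|by rewrite /lin le_max lexx|].
by rewrite /lin ge_max; apply/andP; split; [rewrite !mulr_ge0// ltW|lra].
Qed.

End linear_vs_quadratic.

Lemma measurable_max0_powR (R : realType) (s : R) (f : R -> R) (D : set R) :
  measurable_fun D f -> measurable_fun D (fun t => Num.max 0 (f t) `^ s).
Proof.
move=> mf; apply: (measurableT_comp (measurable_powR s)).
exact: measurable_maxr.
Qed.

(** The corrections [g1] and [g2] are extended by zero outside [A] and [B]. Being nonnegative on
    [D], they may both count on an overlap, so the two pieces need only cover [D]. *)
Lemma ge0_le_integral2 d (T : measurableType d) (R : realType)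
    (mu : {measure set T -> \bar R}) (D A B : set T) (f g g1 g2 : T -> R) (c1 c2 : R) :
  measurable D -> measurable A -> measurable B ->
  measurable_fun setT f -> measurable_fun setT g ->
  measurable_fun setT g1 -> measurable_fun setT g2 ->
  (forall t, D t -> 0 <= f t) -> (forall t, D t -> 0 <= g t) ->
  (forall t, (D `&` A) t -> 0 <= g1 t) -> (forall t, (D `&` B) t -> 0 <= g2 t) ->
  (forall t, (D `&` A) t -> f t <= g t + g1 t) ->
  (forall t, (D `&` B) t -> f t <= g t + g2 t) ->
  D `<=` A `|` B ->
  (\int[mu]_(t in D `&` A) (g1 t)%:E <= c1%:E)%E ->
  (\int[mu]_(t in D `&` B) (g2 t)%:E <= c2%:E)%E ->
  (\int[mu]_(t in D) (f t)%:E <= \int[mu]_(t in D) (g t)%:E + (c1 + c2)%:E)%E.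
Proof.
move=> mD mA mB mf mg mg1 mg2 f0 g0 g10 g20 fA fB DAB h1 h2.
have mE (h : T -> R) : measurable_fun setT h -> measurable_fun D (fun t => (h t)%:E).
  by move=> mh; apply/measurable_EFinP; exact: measurable_funTS.
pose p1 := (fun t => (g1 t)%:E) \_ A; pose p2 := (fun t => (g2 t)%:E) \_ B.
have mp1 : measurable_fun D p1.
  apply: measurable_funTS; apply: (measurable_restrictT _ mA).1.
  by apply/measurable_EFinP; exact: measurable_funTS.
have mp2 : measurable_fun D p2.
  apply: measurable_funTS; apply: (measurable_restrictT _ mB).1.
  by apply/measurable_EFinP; exact: measurable_funTS.
have p10 t : D t -> (0 <= p1 t)%E.
  by move=> Dt; rewrite /p1 patchE; case: ifPn => // /set_mem At; rewrite lee_fin g10.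
have p20 t : D t -> (0 <= p2 t)%E.
  by move=> Dt; rewrite /p2 patchE; case: ifPn => // /set_mem Bt; rewrite lee_fin g20.
apply: (@le_trans _ _ (\int[mu]_(t in D) ((g t)%:E + (p1 t + p2 t)))%E).
  apply: ge0_le_integral.
  - exact: mD.
  - by move=> t Dt; rewrite lee_fin f0.
  - exact: mE.
  - by apply: emeasurable_funD; [exact: mE|exact: emeasurable_funD].
  - move=> t Dt; have [At|Bt] := DAB t Dt.
      apply: (@le_trans _ _ ((g t)%:E + p1 t)%E).
        by rewrite /p1 patchE mem_set// -EFinD lee_fin fA.
      by apply: leeD => //; rewrite leeDl// p20.
    apply: (@le_trans _ _ ((g t)%:E + p2 t)%E).
      by rewrite /p2 patchE mem_set// -EFinD lee_fin fB.
    by apply: leeD => //; rewrite leeDr// p10.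
rewrite ge0_integralD.
- rewrite ge0_integralD// EFinD; apply: leeD => //.
  by apply: leeD; rewrite /p1 /p2 -integral_mkcondr.
- exact: mD.
- by move=> t Dt; rewrite lee_fin g0.
- exact: mE.
- by move=> t Dt; rewrite adde_ge0// ?p10// p20.
- exact: emeasurable_funD.
Qed.

Section halfline_quadratic.
Context {R : realType} (s : R).
Hypotheses (s0 : 0 < s) (s1 : s < 1).
Let w (t : R) := t `^ (- (1 + 2 * s)).

(** Before the zero [T] of the quadratic the error is [k^s T^(s-1) t^(-s)], with integral at most
    [k^s / (1 - s)]; beyond it the error is [k^s T^s t^(-(1+s))], with integral at most [k^s / s].
    The powers of [T] cancel, so the bound depends neither on [a] and [b] nor on the truncation
    [e]. *)
Lemma halfline_lin_le_quad (a b k e : R) : 0 < a -> 0 < k -> 0 < e ->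
  (\int[lebesgue_measure]_(t in `[e, +oo[) (Num.max 0 (a + b * t) `^ s * w t)%:E <=
   \int[lebesgue_measure]_(t in `[e, +oo[)
      (Num.max 0 (a + b * t - k * t ^+ 2) `^ s * w t)%:E
   + (k `^ s / (1 - s) + k `^ s / s)%:E)%E.
Proof.
move=> a0 k0 e0; have [T T0 rootT] := quadratic_pos_root b a0 k0.
have s'0 : 0 < 1 - s by rewrite subr_gt0.
have kT0 : 0 < k * T by exact: mulr_gt0.
have mw : measurable_fun [set: R] w by exact: measurable_powR.
have mlin : measurable_fun [set: R] (fun t => a + b * t) by exact: measurable_funD.
have mquad : measurable_fun [set: R] (fun t => a + b * t - k * t ^+ 2).
  by apply: measurable_funB => //; exact: measurable_funM.
have pw p (t : R) : 0 < t -> t `^ p * w t = t `^ (p - (1 + 2 * s)).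
  by move=> t0; rewrite /w -powRD// (gt_eqF t0) implybT.
have belowE t : 0 < t ->
    k * t ^+ 2 * (k * T * t) `^ (s - 1) * w t = k `^ s * T `^ (s - 1) * t `^ (- s).
  move=> t0; rewrite (powRM _ (ltW kT0) (ltW t0)) (powRM _ (ltW k0) (ltW T0)).
  have -> : k `^ s = k * k `^ (s - 1) by rewrite mulr_powR// subrK.
  have -> : t `^ (- s) = t ^+ 2 * (t `^ (s - 1) * w t).
    rewrite pw// expr2 -mulrA !mulr_powR//; congr (_ `^ _); ring.
  ring.
have aboveE t : 0 < t -> (k * T * t) `^ s * w t = k `^ s * T `^ s * t `^ (- (1 + s)).
  move=> t0; rewrite (powRM _ (ltW kT0) (ltW t0)) (powRM _ (ltW k0) (ltW T0)).
  rewrite -!mulrA pw//; congr (_ * (_ * _ `^ _)); ring.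
apply: (@ge0_le_integral2 _ (measurableTypeR R) R lebesgue_measure `[e, +oo[%classic
  `[e, T]%classic `[T, +oo[%classic
  (fun t => Num.max 0 (a + b * t) `^ s * w t)
  (fun t => Num.max 0 (a + b * t - k * t ^+ 2) `^ s * w t)
  (fun t => k `^ s * T `^ (s - 1) * t `^ (- s))
  (fun t => k `^ s * T `^ s * t `^ (- (1 + s)))).
- exact: measurable_itv.
- exact: measurable_itv.
- exact: measurable_itv.
- by apply: measurable_funM => //; exact: measurable_max0_powR.
- by apply: measurable_funM => //; exact: measurable_max0_powR.
- by apply: measurable_funM => //; exact: measurable_powR.
- by apply: measurable_funM => //; exact: measurable_powR.
- by move=> t _; apply: mulr_ge0; exact: powR_ge0.
- by move=> t _; apply: mulr_ge0; exact: powR_ge0.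
- by move=> t _; apply: mulr_ge0; [apply: mulr_ge0|]; exact: powR_ge0.
- by move=> t _; apply: mulr_ge0; [apply: mulr_ge0|]; exact: powR_ge0.
- move=> t [] /=; rewrite !in_itv /= andbT => et /andP[_ tT].
  have t0 := lt_le_trans e0 et.
  rewrite -belowE// -mulrDl; apply: ler_wpM2r; first exact: powR_ge0.
  exact: lin_le_quad_below.
- move=> t [] /=; rewrite !in_itv /= !andbT => et Tt.
  have t0 := lt_le_trans e0 et.
  rewrite -aboveE// -mulrDl; apply: ler_wpM2r; first exact: powR_ge0.
  apply: (le_trans (lin_le_quad_above s0 a0 k0 T0 rootT Tt)).
  by rewrite lerDr; exact: powR_ge0.
- move=> t /=; rewrite !in_itv /= !andbT => et.
  by have [tT|/ltW Tt] := leP t T; [left; rewrite et|right].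
- rewrite setIidr; last by move=> t /=; rewrite !in_itv /= andbT => /andP[].
  under eq_integral do rewrite EFinM.
  have c0 : 0 <= k `^ s * T `^ (s - 1) by apply: mulr_ge0; exact: powR_ge0.
  have mp (q : R) : measurable_fun `[e, T] (fun t => (t `^ q)%:E).
    by apply/measurable_EFinP/measurable_funTS; exact: measurable_powR.
  rewrite ge0_integralZl_EFin; last exact: c0.
  2: exact: measurable_itv.
  2: by move=> t _; rewrite lee_fin powR_ge0.
  2: exact: mp.
  (* When [T <= e], the interval [[e, T]] has at most one point and contributes nothing. *)
  have [eT|Te] := ltP e T; last first.
    rewrite (_ : integral _ _ _ = 0)%E.
      by rewrite mule0 lee_fin divr_ge0 ?powR_ge0// ltW.
    apply: (@integral_Sset1 _ _ _ e) => t /=; rewrite in_itv /= => /andP[et tT].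
    by apply/eqP; rewrite eq_le et (le_trans tT).
  have := integral_powR_itv (lt0r_neq0 s'0) e0 eT.
  have -> : 1 - s - 1 = - s by ring.
  move=> ->; rewrite -EFinM lee_fin.
  rewrite mulrA ler_wpM2r ?invr_ge0 ?(ltW s'0)//.
  rewrite -mulrA ler_piMr ?powR_ge0//.
  rewrite -(opprB 1 s) powRN mulrC ler_pdivrMr ?powR_gt0// mul1r gerBl.
  exact: powR_ge0.
- apply: (@le_trans _ _ (\int[lebesgue_measure]_(t in `[T, +oo[)
      (k `^ s * T `^ s * t `^ (- (1 + s)))%:E)%E).
    apply: ge0_subset_integral.
    + by apply: measurableI; exact: measurable_itv.
    + exact: measurable_itv.
    + apply/measurable_EFinP/measurable_funTS.
      by apply: measurable_funM => //; exact: measurable_powR.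
    + by move=> t _; rewrite lee_fin; apply: mulr_ge0; [apply: mulr_ge0|]; exact: powR_ge0.
    + exact: subIsetr.
  under eq_integral do rewrite EFinM.
  rewrite ge0_integralZl_EFin.
  + rewrite (integral_powR_tail s0 T0) -EFinM lee_fin powRN mulrA mulfK//.
    exact/lt0r_neq0/powR_gt0.
  + exact: measurable_itv.
  + by move=> t _; rewrite lee_fin powR_ge0.
  + by apply/measurable_EFinP/measurable_funTS; exact: measurable_powR.
  + by apply: mulr_ge0; exact: powR_ge0.
Qed.

End halfline_quadratic.

Lemma lee_addD2 (R : realType) (x i1 i2 j1 j2 : \bar R) (c d : R) :
  (x <= i1 + i2 + d%:E)%E -> (i1 <= j1 + c%:E)%E -> (i2 <= j2 + c%:E)%E ->
  (x <= j1 + j2 + (2 * c + d)%:E)%E.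
Proof.
move=> h h1 h2; apply: (le_trans h); rewrite EFinD addeA; apply: leeD => //.
have -> : 2 * c = c + c by ring.
by apply: (le_trans (leeD h1 h2)); rewrite EFinD addeACA.
Qed.

(** * The estimate on a full line *)

Lemma ge0_integral_normr_gt (R : realType) (e : R) (f : R -> \bar R) :
  0 <= e -> measurable_fun [set: R] f -> (forall t, 0 <= f t)%E ->
  (\int[lebesgue_measure]_(t in [set t : R | (e < `|t|)%R]) f t =
   \int[lebesgue_measure]_(t in `[e, +oo[) f t +
   \int[lebesgue_measure]_(t in `[e, +oo[) f (- t)%R)%E.
Proof.
move=> e0 mf f0.
have mfN : measurable_fun [set: R] (f \o -%R) by exact: measurableT_comp.
have Nitv : (-%R : R -> measurableTypeR R) @^-1` `]e, +oo[ = `]-oo, (- e)[%classic.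
  by rewrite opp_preimage_itvbndy.
have -> : [set t : R | e < `|t|] = `]e, +oo[%classic `|` `]-oo, (- e)[%classic.
  apply/seteqP; split => t /=; rewrite !in_itv /= andbT.
    by rewrite real_lter_normr ?num_real// => /orP[]; [left|right; rewrite ltrNr].
  by case; rewrite real_lter_normr ?num_real// => h; apply/orP; [left|right; rewrite ltrNr].
rewrite ge0_integral_setU.
- rewrite integral_itv_obnd_cbnd; last exact: measurable_funTS.
  congr (_ + _)%E.
  rewrite -[RHS]integral_itv_obnd_cbnd; last exact: measurable_funTS.
  rewrite -Nitv.
  transitivity (\int[pushforward lebesgue_measure (-%R : R -> measurableTypeR R)]_(t in `]e, +oo[) (f \o -%R) t)%E.
    have mN : measurable_fun [set: measurableTypeR R] (-%R : R -> measurableTypeR R) by [].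
    rewrite (ge0_integral_pushforward mN).
    + by apply: eq_integral => t _ /=; rewrite opprK.
    + exact: measurable_itv.
    + exact: (measurable_funTS mfN).
    + by move=> t _ /=.
  by apply: eq_measure_integral => A mA _; exact: lebesgue_measureN.
- exact: measurable_itv.
- exact: measurable_itv.
- exact: measurable_funTS.
- by [].
- apply/disj_setPS => t [] /=; rewrite !in_itv /= andbT => et te.
  by have := lt_trans et te; rewrite ltNge ge0_cp.
Qed.

Section line_quadratic.
Context {R : realType} (s : R).
Hypotheses (s0 : 0 < s) (s1 : s < 1).
Let w (t : R) := t `^ (- (1 + 2 * s)).

Let mw : measurable_fun [set: R] w. Proof. exact: measurable_powR. Qed.

(** Factoring out [a^s] reduces the claim to [halfline_lower_bound] with [g = b / a]. That lemma
    asks for a positive slope; for [b = 0] both profiles are constant and equality holds. *)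
Lemma halfline_lin_lower_bound (a b e : R) : 0 <= b -> 0 < a -> 0 < e -> `|b| * e < a ->
  ((2 * a `^ s)%:E * \int[lebesgue_measure]_(t in `[e, +oo[) (w t)%:E <=
   \int[lebesgue_measure]_(t in `[e, +oo[) (Num.max 0 (a + b * t) `^ s * w t)%:E
   + \int[lebesgue_measure]_(t in `[e, +oo[) (Num.max 0 (a + - b * t) `^ s * w t)%:E
   + (a `^ s * ((`|b| / a * e) ^+ 2 * e `^ (- (2 * s)) / (2 * s)))%:E)%E.
Proof.
move=> b0 a0 e0; rewrite ger0_norm// => be.
have mlin c : measurable_fun [set: R] (fun t => a + c * t) by exact: measurable_funD.
have mpow c : measurable_fun [set: R] (fun t => Num.max 0 (a + c * t) `^ s * w t).
  by apply: measurable_funM => //; exact: measurable_max0_powR.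
have as0 : 0 < a `^ s by exact: powR_gt0.
have s20 : 0 < 2 * s by rewrite mulr_gt0.
rewrite (integral_powR_tail s20 e0).
rewrite -ge0_integralD; first last.
- by apply/measurable_EFinP/measurable_funTS; exact: mpow.
- by move=> t _; rewrite lee_fin; apply: mulr_ge0; exact: powR_ge0.
- by apply/measurable_EFinP/measurable_funTS; exact: mpow.
- by move=> t _; rewrite lee_fin; apply: mulr_ge0; exact: powR_ge0.
- exact: measurable_itv.
have -> : ((2 * a `^ s)%:E * (e `^ (- (2 * s)) / (2 * s))%:E)%E
    = (a `^ s * (s^-1 * e `^ (- (2 * s))))%:E.
  by rewrite -EFinM; congr (_%:E); field; exact: lt0r_neq0.
move: b0; rewrite le_eqVlt => /orP[/eqP b0|b0].
  rewrite -b0 mul0r mul0r expr0n /= !mul0r mulr0 adde0.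
  under eq_integral => t _.
    rewrite oppr0 mul0r addr0 (max_r (ltW a0)) -EFinD -mulr2n -mulr_natl mulrA EFinM.
    over.
  rewrite ge0_integralZl_EFin.
  - rewrite (integral_powR_tail s20 e0) -EFinM lee_fin.
    rewrite le_eqVlt; apply/orP; left; apply/eqP.
    by field; exact: lt0r_neq0.
  - exact: measurable_itv.
  - by move=> t _; rewrite lee_fin powR_ge0.
  - by apply/measurable_EFinP/measurable_funTS.
  - by rewrite mulr_ge0// ltW.
have ge1 : b / a * e < 1 by rewrite mulrAC ltr_pdivrMr// mul1r.
have h := halfline_lower_bound s0 (ltW s1) (divr_gt0 b0 a0) e0 ge1.
have scale (c t : R) : Num.max 0 (a + c * t) `^ s = a `^ s * Num.max 0 (1 + c / a * t) `^ s.
  have m0 : 0 <= Num.max 0 (1 + c / a * t) by rewrite le_max lexx.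
  rewrite -(powRM _ (ltW a0) m0) maxr_pMr ?(ltW a0)// mulr0; congr (Num.max _ _ `^ _).
  by field; exact: lt0r_neq0.
have := lee_wpmul2l (ltW as0 : (0 <= (a `^ s)%:E)%E) h.
rewrite -EFinM muleDr//; last first.
  rewrite ge0_adde_def// inE; last first.
    rewrite lee_fin; apply: divr_ge0; last exact: ltW.
    by apply: mulr_ge0; [exact: sqr_ge0|exact: powR_ge0].
  by apply: integral_ge0 => t _; rewrite lee_fin; apply: mulr_ge0;
    [apply: addr_ge0|]; exact: powR_ge0.
rewrite -EFinM -ge0_integralZl_EFin.
- congr (_ <= _ + _)%E; apply: eq_integral => t _.
  rewrite -EFinM -EFinD 2!scale; congr (_%:E).
  have -> : 1 + - b / a * t = 1 - b / a * t by ring.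
  by rewrite /w; ring.
- exact: measurable_itv.
- move=> t _; rewrite lee_fin; apply: mulr_ge0; [apply: addr_ge0|]; exact: powR_ge0.
- apply/measurable_EFinP/measurable_funTS; apply: measurable_funM => //.
  by apply: measurable_funD; apply: measurable_max0_powR;
    [apply: measurable_funD|apply: measurable_funB].
- exact: ltW.
Qed.

(** The left side carries the value of the profile at [t = 0]. Passing to the linear part costs one
    constant for each half-line, uniformly in [e]; the linear part itself costs a term of order
    [e^(2 - 2s)], which vanishes in the limit as s is below 1. *)
Lemma line_quadratic_bound (a b k e : R) : 0 < a -> 0 < k -> 0 < e -> `|b| * e < a ->
  (\int[lebesgue_measure]_(t in [set t : R | (e < `|t|)%R]) (a `^ s * w `|t|)%:E <=
   \int[lebesgue_measure]_(t in [set t : R | (e < `|t|)%R])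
      (Num.max 0 (a + b * t - k * t ^+ 2) `^ s * w `|t|)%:E
   + (2 * (k `^ s / (1 - s) + k `^ s / s) +
      a `^ s * ((`|b| / a * e) ^+ 2 * e `^ (- (2 * s)) / (2 * s)))%:E)%E.
Proof.
move=> a0 k0 e0 be.
have mwn : measurable_fun [set: R] (fun t : R => w `|t|).
  by apply: (measurableT_comp mw); exact: normr_measurable.
have mq c : measurable_fun [set: R] (fun t => Num.max 0 (a + c * t - k * t ^+ 2) `^ s).
  apply: measurable_max0_powR; apply: measurable_funB.
    exact: measurable_funD.
  exact: measurable_funM.
have wE (f : R -> R) : (\int[lebesgue_measure]_(t in `[e, +oo[) (f t * w `|t|)%:E =
     \int[lebesgue_measure]_(t in `[e, +oo[) (f t * w t)%:E)%E.
  apply: eq_integral => t; rewrite inE /= in_itv /= andbT => et.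
  by rewrite ger0_norm// (le_trans (ltW e0)).
rewrite (ge0_integral_normr_gt (ltW e0)); first last.
- by move=> t; rewrite lee_fin; apply: mulr_ge0; exact: powR_ge0.
- by apply/measurable_EFinP; exact: measurable_funM.
rewrite (ge0_integral_normr_gt (ltW e0)); first last.
- by move=> t; rewrite lee_fin; apply: mulr_ge0; exact: powR_ge0.
- by apply/measurable_EFinP; exact: measurable_funM.
have NE (f : R -> R) : (\int[lebesgue_measure]_(t in `[e, +oo[) (f t * w `|- t|)%:E =
     \int[lebesgue_measure]_(t in `[e, +oo[) (f t * w t)%:E)%E.
  by rewrite -wE; apply: eq_integral => t _; rewrite normrN.
rewrite (wE (fun=> a `^ s)) (NE (fun=> a `^ s)).
rewrite (wE (fun t => Num.max 0 (a + b * t - k * t ^+ 2) `^ s)).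
rewrite (NE (fun t => Num.max 0 (a + b * - t - k * (- t) ^+ 2) `^ s)).
pose I c := (\int[lebesgue_measure]_(t in `[e, +oo[) (Num.max 0 (a + c * t) `^ s * w t)%:E)%E.
pose J c := (\int[lebesgue_measure]_(t in `[e, +oo[)
   (Num.max 0 (a + c * t - k * t ^+ 2) `^ s * w t)%:E)%E.
have JN : (\int[lebesgue_measure]_(t in `[e, +oo[)
   (Num.max 0 (a + b * - t - k * (- t) ^+ 2) `^ s * w t)%:E = J (- b)%R)%E.
  by apply: eq_integral => t _; rewrite mulrN mulNr sqrrN.
rewrite JN -/(J b).
(* Changing the sign of [b] exchanges the two half-lines, so the case of a nonnegative slope
   suffices. *)
have h1 : ((2 * a `^ s)%:E * \int[lebesgue_measure]_(t in `[e, +oo[) (w t)%:E <=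
  I b + I (- b)%R + (a `^ s * ((`|b| / a * e) ^+ 2 * e `^ (- (2 * s)) / (2 * s)))%:E)%E.
  have [b0|/ltW b0] := leP 0 b; first exact: halfline_lin_lower_bound.
  have nb : 0 <= - b by rewrite oppr_ge0.
  have := @halfline_lin_lower_bound a (- b) e nb a0 e0.
  rewrite normrN -/(I (- b)) -/(I (- - b)) opprK => /(_ be) h.
  by rewrite (addeC (I b)).
have h2 := halfline_lin_le_quad s0 s1 b a0 k0 e0.
have h3 := halfline_lin_le_quad s0 s1 (- b) a0 k0 e0.
rewrite -/(I b) -/(J b) in h2; rewrite -/(I (- b)) -/(J (- b)) in h3.
have -> : (\int[lebesgue_measure]_(t in `[e, +oo[) (a `^ s * w t)%:E
   = (a `^ s)%:E * \int[lebesgue_measure]_(t in `[e, +oo[) (w t)%:E)%E.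
  under eq_integral do rewrite EFinM.
  apply: ge0_integralZl_EFin.
  - exact: measurable_itv.
  - by move=> t _; rewrite lee_fin powR_ge0.
  - by apply/measurable_EFinP/measurable_funTS.
  - exact: powR_ge0.
have dbl (x : \bar R) : ((a `^ s)%:E * x + (a `^ s)%:E * x = (2 * a `^ s)%:E * x)%E.
  have as0 : (0 <= (a `^ s)%:E)%E by rewrite lee_fin powR_ge0.
  have -> : 2 * a `^ s = a `^ s + a `^ s by ring.
  by rewrite EFinD (ge0_muleDl x as0 as0).
rewrite dbl; exact: (lee_addD2 h1 h2 h3).
Qed.


End line_quadratic.

(** * Lebesgue measure on row vectors *)

(* The measure structure of a pushforward depends on a measurability proof, which
   is not inferred. *)
Definition scaled_lebesgue_measure (R : realType) (k : R) :
    {measure set (measurableTypeR R) -> \bar R} :=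
  mscale (NngNum (normr_ge0 k))
    (measure_function_pushforward__canonical__measure_function_Measure
      lebesgue_measure (mulrl_measurable k : measurable_fun [set: measurableTypeR R]
        ( *%R k : measurableTypeR R -> measurableTypeR R))).

(** By uniqueness of Lebesgue measure it suffices to compare on intervals []a, b]]. For negative [k]
    the preimage is [[b / k, a / k[]: the endpoints are exchanged and the closed end moves to the
    left. *)
Lemma scaled_lebesgue_measureE (R : realType) (k : R) (A : set R) : k != 0 ->
  measurable A -> scaled_lebesgue_measure k A = lebesgue_measure A.
Proof.
move=> k0 mA; apply/esym; apply: lebesgue_measure_unique => // X [[a b]] _ <-.
rewrite -[RHS]/(`|k|%:E * lebesgue_measure ( *%R k @^-1` `]a, b]))%E.
have [k_gt0|k_le0] := ltP 0 k.
  rewrite [X in (_ * lebesgue_measure X)%E](_ : _ = `]a / k, b / k]%classic); last first.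
    by apply/seteqP; split => x /=; rewrite !in_itv /= ltr_pdivrMr// ler_pdivlMr// [x * k]mulrC.
  rewrite !lebesgue_measure_itv /= !lte_fin ltr_pM2r ?invr_gt0//.
  case: ifP => _; last by rewrite mule0.
  by rewrite gtr0_norm// -!EFinB -EFinM -mulrBl mulrCA mulfV// mulr1.
have k_lt0 : k < 0 by rewrite lt_neqAle k0.
rewrite [X in (_ * lebesgue_measure X)%E](_ : _ = `[b / k, a / k[%classic); last first.
  apply/seteqP; split => x /=; rewrite !in_itv /= ltr_ndivlMr// ler_ndivrMr// [x * k]mulrC.
    by move=> /andP[-> ->].
  by move=> /andP[-> ->].
rewrite !lebesgue_measure_itv /= !lte_fin ltr_nM2r ?invr_lt0//.
case: ifP => _; last by rewrite mule0.
by rewrite ltr0_norm// -!EFinB -EFinM -mulrBl mulrCA mulNr mulfV// mulrN1 opprB.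
Qed.

Lemma ge0_integral_scaler (R : realType) (k : R) (f : R -> \bar R) : k != 0 ->
  measurable_fun [set: R] f -> (forall t, 0 <= f t)%E ->
  (\int[lebesgue_measure]_t f t = `|k|%:E * \int[lebesgue_measure]_t f (k * t)%R)%E.
Proof.
move=> k0 mf f0.
transitivity (\int[scaled_lebesgue_measure k]_t f t)%E.
  by apply: eq_measure_integral => A mA _; rewrite scaled_lebesgue_measureE.
rewrite ge0_integral_mscale//; congr (_ * _)%E.
by rewrite (ge0_integral_pushforward (mulrl_measurable k : measurable_fun
  [set: measurableTypeR R] ( *%R k : measurableTypeR R -> measurableTypeR R))).
Qed.

Section lebesgue_rV_theory.
Context {R : realType}.

Lemma ge0_integral_lebesgue_rVS n (F : 'rV[R]_n.+1 -> \bar R) :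
  measurable_fun [set: 'rV[R]_n.+1] F -> (forall y, 0 <= F y)%E ->
  (\int[lebesgue_rV n.+1]_y F y =
   \int[lebesgue_measure]_t \int[lebesgue_rV n]_y F (cons_rV (t, y)))%E.
Proof.
move=> mF F0.
transitivity (\int[pushforward (lebesgue_measure \x lebesgue_rV n)%E (@cons_rV R n)]_y F y)%E => //.
rewrite (ge0_integral_pushforward (@measurable_cons_rV R n)) => //.
rewrite preimage_setT fubini_tonelli1 => //.
  by apply: measurableT_comp => //; exact: measurable_cons_rV.
by move=> x; exact: F0.
Qed.

Lemma measurable_scale_rV n (k : R) :
  measurable_fun [set: 'rV[R]_n] (fun y : 'rV[R]_n => k *: y).
Proof.
apply: measurable_fun_rV => i.
rewrite (_ : _ \o _ = fun y : 'rV[R]_n => k * rV_coord i y).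
  by apply: measurable_funM => //; exact: measurable_rV_coord.
by apply/funext => y; rewrite /rV_coord /= mxE.
Qed.

Lemma scale_cons_rV n (k t : R) (y : 'rV[R]_n) :
  k *: cons_rV (t, y) = cons_rV (k * t, k *: y).
Proof.
apply/rowP => i; rewrite mxE; case: (unliftP ord0 i) => [j ->|->].
  by rewrite !tl_cons_rV mxE.
by rewrite !hd_cons_rV.
Qed.

(** Induction on the dimension: the first coordinate is split off by Tonelli and contributes one
    factor [|k|]. *)
Lemma ge0_integral_lebesgue_rV_scale n (k : R) (F : 'rV[R]_n -> \bar R) : k != 0 ->
  measurable_fun [set: 'rV[R]_n] F -> (forall y, 0 <= F y)%E ->
  (\int[lebesgue_rV n]_y F y =
   (`|k| ^+ n)%:E * \int[lebesgue_rV n]_y F (k *: y)%R)%E.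
Proof.
move=> k0; elim: n F => [|n IH] F mF F0.
  rewrite expr0 mul1e /=; apply: eq_integral => y _.
  by congr F; apply/rowP => -[].
have mFk : measurable_fun [set: 'rV[R]_n.+1] (fun y => F (k *: y)).
  by apply: (measurableT_comp mF); exact: measurable_scale_rV.
have mc t : measurable_fun [set: 'rV[R]_n] (fun y : 'rV[R]_n => cons_rV (t, y)).
  apply: (measurableT_comp (@measurable_cons_rV R n)); exact: measurable_pair1.
have mI (G : 'rV[R]_n.+1 -> \bar R) : measurable_fun [set: 'rV[R]_n.+1] G ->
    (forall y, 0 <= G y)%E ->
    measurable_fun [set: R] (fun t => \int[lebesgue_rV n]_y G (cons_rV (t, y)))%E.
  move=> mG G0; apply: (@measurable_fun_fubini_tonelli_F _ _ _ _ _ _ (G \o @cons_rV R n)).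
    by apply: measurableT_comp => //; exact: measurable_cons_rV.
  by move=> x; exact: G0.
rewrite (ge0_integral_lebesgue_rVS mF F0).
rewrite (ge0_integral_lebesgue_rVS mFk (fun y => F0 _)).
rewrite (ge0_integral_scaler k0).
- under [in RHS]eq_integral do under eq_integral do rewrite scale_cons_rV.
  under [in LHS]eq_integral => t _.
    rewrite (IH (fun y => F (cons_rV (k * t, y)))) => //; last first.
      by apply: (measurableT_comp mF).
    over.
  rewrite ge0_integralZl_EFin => //.
  + by rewrite muleA -EFinM -exprS.
  + by move=> t _; exact: integral_ge0.
  + under eq_fun do under eq_integral do rewrite -scale_cons_rV.
    exact: (mI _ mFk).
- exact: mI.
- by move=> t; exact: integral_ge0.
Qed.

End lebesgue_rV_theory.

(** * Euclidean norm and Borel sets *)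

Section enorm_theory.
Context {R : realType} {n : nat}.
Implicit Types (x y z : 'rV[R]_n) (k : R).

Let dot x y := \sum_(i < n) x 0 i * y 0 i.

Lemma enorm_sqr x : enorm x ^+ 2 = dot x x.
Proof.
by rewrite /enorm sqr_sqrtr// sumr_ge0// => i _; exact: sqr_ge0.
Qed.

Lemma enorm_ge0 x : 0 <= enorm x.
Proof. exact: sqrtr_ge0. Qed.

Lemma enormZ k x : enorm (k *: x) = `|k| * enorm x.
Proof.
rewrite /enorm -sqrtr_sqr -sqrtrM ?sqr_ge0// mulr_sumr; congr (Num.sqrt _).
by apply: eq_bigr => i _; rewrite mxE exprMn.
Qed.

Lemma enormN x : enorm (- x) = enorm x.
Proof. by rewrite -scaleN1r enormZ normrN normr1 mul1r. Qed.

Lemma enorm0 : enorm (0 : 'rV[R]_n) = 0.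
Proof. by rewrite -(scale0r 0) enormZ normr0 mul0r. Qed.

Lemma coord_le_enorm x i : `|x 0 i| <= enorm x.
Proof.
rewrite -sqrtr_sqr ler_wsqrtr// (bigD1 i)//= lerDl sumr_ge0// => j _.
exact: sqr_ge0.
Qed.

Lemma enorm_eq0 x : enorm x = 0 -> x = 0.
Proof.
move=> x0; apply/rowP => i; rewrite mxE; apply/eqP; rewrite -normr_eq0 eq_le normr_ge0.
by rewrite -x0 coord_le_enorm.
Qed.

Lemma enorm_gt0 x : x != 0 -> 0 < enorm x.
Proof.
by move=> x0; rewrite lt_neqAle enorm_ge0 andbT; apply: contra x0 => /eqP /esym/enorm_eq0 ->.
Qed.

Lemma enorm_le_coord x k : (forall i, `|x 0 i| <= k) -> enorm x <= n%:R * k.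
Proof.
move=> xk; have [n0|n0] := posnP n.
  rewrite /enorm; move: x {xk}; rewrite n0 => x.
  by rewrite big_ord0 sqrtr0 mul0r.
have k0 : 0 <= k by apply: le_trans (xk (Ordinal n0)).
rewrite -(ger0_norm (mulr_ge0 (ler0n R n) k0)) -sqrtr_sqr ler_wsqrtr//.
apply: (@le_trans _ _ (\sum_(i < n) k ^+ 2)).
  by apply: ler_sum => i _; rewrite -[leLHS]real_normK ?num_real// lerXn2r ?nnegrE.
rewrite sumr_const card_ord -[leLHS]mulr_natl exprMn; apply: ler_wpM2r (sqr_ge0 _) _ _ _.
by rewrite -natrX ler_nat -{1}(expn1 n) leq_pexp2l.
Qed.

(** Cauchy-Schwarz: for e = 1 and e = -1 the sum of the squares of [|y| x_i - e |x| y_i] is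
    nonnegative, and it equals [2 |x| |y| (|x| |y| - e dot x y)]. *)
Lemma dot_le_enorm x y : `|dot x y| <= enorm x * enorm y.
Proof.
have [->|x0] := eqVneq x 0.
  by rewrite enorm0 mul0r /dot big1 ?normr0// => i _; rewrite mxE mul0r.
have [->|y0] := eqVneq y 0.
  by rewrite enorm0 mulr0 /dot big1 ?normr0// => i _; rewrite mxE mulr0.
have ex := enorm_gt0 x0; have ey := enorm_gt0 y0.
have half (e : R) : e ^+ 2 = 1 -> e * dot x y <= enorm x * enorm y.
  move=> e2.
  have : 0 <= \sum_(i < n) (enorm y * x 0 i - e * (enorm x * y 0 i)) ^+ 2.
    by apply: sumr_ge0 => i _; exact: sqr_ge0.
  have -> : \sum_(i < n) (enorm y * x 0 i - e * (enorm x * y 0 i)) ^+ 2 =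
      enorm y ^+ 2 * dot x x - 2 * e * enorm x * enorm y * dot x y
      + enorm x ^+ 2 * (e ^+ 2 * dot y y).
    rewrite /dot !mulr_sumr -sumrB -big_split /=; apply: eq_bigr => i _; ring.
  rewrite e2 mul1r -!enorm_sqr.
  have -> : enorm y ^+ 2 * enorm x ^+ 2 - 2 * e * enorm x * enorm y * dot x y +
      enorm x ^+ 2 * enorm y ^+ 2 =
      (enorm x * enorm y) * (2 * (enorm x * enorm y - e * dot x y)) by ring.
  by rewrite pmulr_rge0 ?mulr_gt0// pmulr_rge0// subr_ge0.
rewrite ler_norml; apply/andP; split.
  by rewrite lerNl -mulN1r half// sqrrN expr1n.
by rewrite -[leLHS]mul1r half// expr1n.
Qed.

Lemma enormD_sqr x y : enorm (x + y) ^+ 2 = enorm x ^+ 2 + 2 * dot x y + enorm y ^+ 2.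
Proof.
rewrite !enorm_sqr /dot mulr_sumr -!big_split /=; apply: eq_bigr => i _.
by rewrite mxE; ring.
Qed.

Lemma ler_enormD x y : enorm (x + y) <= enorm x + enorm y.
Proof.
rewrite -ler_sqr ?nnegrE ?addr_ge0 ?enorm_ge0// enormD_sqr.
have := dot_le_enorm x y; rewrite ler_norml => /andP[_ h].
have -> : (enorm x + enorm y) ^+ 2 =
  enorm x ^+ 2 + 2 * (enorm x * enorm y) + enorm y ^+ 2 by ring.
by rewrite lerD2r lerD2l ler_pM2l.
Qed.

Lemma ler_enormB x y : enorm x - enorm y <= enorm (x - y).
Proof. by rewrite lerBlDr (le_trans _ (ler_enormD _ _))// subrK. Qed.

(** On a line, [r^2 - |.|^2] is thus a concave quadratic with leading coefficient [-|z|^2], to which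
    the one-dimensional estimate applies. *)
Lemma enorm_line (x z : 'rV[R]_n) : exists2 b : R, `|b| <= 2 * (enorm x * enorm z) &
  forall t : R, enorm (x + t *: z) ^+ 2 = enorm x ^+ 2 + b * t + enorm z ^+ 2 * t ^+ 2.
Proof.
exists (2 * dot x z); first by rewrite normrM gtr0_norm// ler_pM2l// dot_le_enorm.
move=> t; rewrite enormD_sqr enormZ exprMn real_normK ?num_real//.
congr (_ + _ + _); last exact: mulrC.
by rewrite -mulrA; congr (_ * _); rewrite mulrC /dot mulr_sumr; apply: eq_bigr => i _; rewrite mxE; ring.
Qed.

Lemma enorm_continuous : continuous (@enorm R n).
Proof.
move=> x; rewrite /enorm; apply: (@continuous_comp _ _ _ _ (@Num.sqrt R)); last first.
  exact: sqrt_continuous.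
apply: continuous_big => [|i _ {}x].
  by move=> -[a b]; exact: (@add_continuous R^o (a, b)).
apply: (@continuous_comp _ _ _ (fun M : 'rV[R]_n => M 0 i) (fun r : R => r ^+ 2)).
  exact: coord_continuous.
exact: exprn_continuous.
Qed.

(** The sigma-algebra is generated by the coordinates, so boxes are measurable; an open set is the
    union of the countably many boxes with rational centre and radius [1 / (k + 1)] that it
    contains. *)
Lemma open_measurable_rV (A : set 'rV[R]_n) : open A -> measurable A.
Proof.
move=> oA.
pose box (q : 'rV[rat]_n * nat) : set 'rV[R]_n :=
  [set x | forall i, `|x 0 i - ratr (q.1 0 i)| < q.2.+1%:R^-1].
have mbox q : measurable (box q).
  rewrite (_ : box q = \bigcap_(i in [set: 'I_n])
      (rV_coord i @^-1` ball (ratr (q.1 0 i) : R) q.2.+1%:R^-1)).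
    apply: fin_bigcap_measurable => // i _; rewrite -[X in measurable X]setTI.
    by apply: measurable_rV_coord => //; exact: measurable_ball.
  apply/seteqP; split => [x xq i _|x xq i].
    by rewrite /= /ball /= distrC; exact: xq.
  by rewrite distrC; exact: (xq i I).
rewrite (_ : A = \bigcup_(q in [set: 'rV[rat]_n * nat]) (if `[< box q `<=` A >] then box q else set0)).
  apply: countable_bigcupT_measurable; first exact: countableP.
  by move=> q; case: ifP => _; [exact: mbox|exact: measurable0].
apply/seteqP; split => [x Ax|x [q _]]; last by case: ifPn => // /asboolP; apply.
have /nbhs_ballP[e /= e0 xe] : nbhs x A by exact: open_nbhs_nbhs.
have [k ke] : exists k : nat, k.+1%:R^-1 < e / 2.
  have e2 : 0 < e / 2 by rewrite divr_gt0.
  exists (Num.truncn (e / 2)^-1).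
  rewrite invf_plt ?posrE//; exact: truncnS_gt.
have hq i : exists q : rat, `|x 0 i - ratr q| < k.+1%:R^-1.
  have h : x 0 i - k.+1%:R^-1 < x 0 i + k.+1%:R^-1.
    by rewrite ltrBlDr -addrA ltrDl addr_gt0// invr_gt0.
  have [q] := rat_in_itvoo h; rewrite in_itv /= => /andP[q1 q2].
  by exists q; rewrite ltr_distlC q1 q2.
pose q : 'rV[rat]_n := \row_i xchoose (hq i).
exists (q, k) => //; have qx : box (q, k) x.
  by move=> i /=; rewrite mxE; exact: (xchooseP (hq i)).
rewrite ifT//; apply/asboolP => y yq; apply: xe; split => // i j.
rewrite ord1 /ball /=; have := yq j; have := qx j; rewrite /= => h1 h2.
rewrite (le_lt_trans (ler_distD (ratr (q 0 j)) _ _))//.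
rewrite [ltRHS]splitr ltrD ?(lt_trans h1)//.
by rewrite distrC (lt_trans h2).
Qed.

Lemma continuous_measurable_rV (f : 'rV[R]_n -> R) :
  continuous f -> measurable_fun [set: 'rV[R]_n] (f : _ -> measurableTypeR R).
Proof.
move=> cf; apply: (measurability _ (RGenOInfty.measurableE R)) => //.
move=> /= _ [_ [a ->] <-]; rewrite setTI.
apply: open_measurable_rV; move/continuousP: cf; apply; exact: interval_open.
Qed.

Lemma measurable_enorm : measurable_fun [set: 'rV[R]_n] (@enorm R n).
Proof. exact: continuous_measurable_rV enorm_continuous. Qed.

End enorm_theory.

(** * Integration along lines through the origin *)

Section lines.
Context {R : realType} (n : nat).
Implicit Types (y z : 'rV[R]_n.+1) (t : R).

Definition annulus : set 'rV[R]_n.+1 := [set z | 1 <= enorm z < 2].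

(* [kern ^~ y] has integral 1, and [kern t (t *: z)] vanishes unless [z] is in the
   annulus: inserting it in an integral and exchanging the integrals gives a
   substitute for polar coordinates. *)
Let kern t y : R :=
  if (enorm y < 2 * `|t|) && (`|t| <= enorm y) then enorm y `^ (- 1) else 0.

Let kern_ge0 t y : 0 <= kern t y.
Proof. by rewrite /kern; case: ifP => // _; exact: powR_ge0. Qed.

Let measurable_kern :
  measurable_fun [set: measurableTypeR R * 'rV[R]_n.+1] (fun p => kern p.1 p.2).
Proof.
have ms : measurable_fun [set: measurableTypeR R * 'rV[R]_n.+1]
    (fun p => enorm p.2 : measurableTypeR R).
  exact: measurableT_comp (@measurable_enorm R n.+1) measurable_snd.
have mf : measurable_fun [set: measurableTypeR R * 'rV[R]_n.+1]
    (fun p => `|p.1 : R| : measurableTypeR R).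
  exact: measurableT_comp (@normr_measurable R setT) measurable_fst.
apply: measurable_fun_ifT.
- apply: measurable_and; last exact: measurable_fun_ler.
  by apply: measurable_fun_ltr => //; apply: measurable_funM.
- by apply: (measurableT_comp (measurable_powR (- 1))).
- exact: measurable_cst.
Qed.

(** The support in [t] consists of two intervals of total length [enorm y], on which the value is
    the inverse of [enorm y]. *)
Let integral_kern y : y != 0 -> (\int[lebesgue_measure]_t (kern t y)%:E = 1)%E.
Proof.
move=> y0; have a0 := enorm_gt0 y0; set a := enorm y in a0 *.
pose A := `]a / 2, a]%classic; pose B := `[- a, - (a / 2)[%classic.
have AB : [disjoint A & B].
  apply/disj_setPS => t []; rewrite /A /B /= !in_itv /= => /andP[at1 _] /andP[_ at2].
  by exfalso; lra.
have mA : measurable (A : set (measurableTypeR R)) by exact: measurable_itv.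
have mB : measurable (B : set (measurableTypeR R)) by exact: measurable_itv.
have mAB : lebesgue_measure (A `|` B) = a%:E.
  transitivity (lebesgue_measure A + lebesgue_measure B)%E.
    by apply: measureU => //; exact/disj_set2P.
  rewrite /A /B !lebesgue_measure_itv /= !lte_fin.
  rewrite ifT; last lra.
  rewrite ifT; last lra.
  by rewrite -!EFinB -EFinD; congr (_%:E); field.
transitivity (\int[lebesgue_measure]_(t in A `|` B) (cst (a `^ (- 1))%:E t))%E.
  rewrite [RHS]integral_mkcond; apply: eq_integral => t _.
  rewrite patchE /kern -/a.
  have [tab|tab] := boolP (t \in A `|` B).
    rewrite ifT//; move: tab; rewrite inE /A /B /= !in_itv /=.
    by case=> /andP[h1 h2]; [rewrite gtr0_norm; lra|rewrite ltr0_norm; lra].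
  rewrite ifF//; apply: contraNF tab => /andP[h1 h2].
  rewrite inE /A /B /= !in_itv /=.
  by have [t0|t0] := ler0P t; move: h1 h2; rewrite ?(ger0_norm (ltW t0)) ?(ler0_norm t0);
    [right|left]; lra.
rewrite integral_cst; last exact: measurableU.
transitivity ((a `^ (- 1))%:E * lebesgue_measure (A `|` B))%E => //.
by rewrite mAB -EFinM powR_inv1 ?ltW// mulVf// gt_eqF.
Qed.

Lemma measurable_line_fun (F : 'rV[R]_n.+1 -> \bar R) :
  measurable_fun [set: 'rV[R]_n.+1] F ->
  measurable_fun [set: measurableTypeR R * 'rV[R]_n.+1]
    (fun p => ((`|p.1 : R| ^+ n)%:E * F ((p.1 : R) *: p.2)))%E.
Proof.
move=> mF.
have msc : measurable_fun [set: measurableTypeR R * 'rV[R]_n.+1]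
    (fun p => (p.1 : R) *: p.2 : 'rV[R]_n.+1).
  apply: measurable_fun_rV => i.
  rewrite (_ : _ \o _ = fun p => p.1 * rV_coord i p.2).
    apply: measurable_funM; first exact: measurable_fst.
    exact: measurableT_comp (measurable_rV_coord i) measurable_snd.
  by apply/funext => p; rewrite /rV_coord /= mxE.
apply: emeasurable_funM; last exact: measurableT_comp mF msc.
apply/measurable_EFinP/measurable_funX.
exact: measurableT_comp (@normr_measurable R setT) measurable_fst.
Qed.

(** The integral over [t] of [kern] is inserted, Tonelli puts [t] outside, and [y = t z] is
    substituted for each fixed nonzero [t]. The Jacobian [|t|^(n+1)] times [kern t (t z)] is
    [|t|^n / |z|] on the annulus, and Tonelli exchanges the integrals back. [F 0 = 0] takes care of
    the origin, where [kern] vanishes. *)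
Lemma ge0_integral_lines (F : 'rV[R]_n.+1 -> \bar R) :
  measurable_fun [set: 'rV[R]_n.+1] F -> (forall y, 0 <= F y)%E -> F 0 = 0%E ->
  (\int[lebesgue_rV n.+1]_y F y =
   \int[lebesgue_rV n.+1]_(z in annulus)
     ((enorm z `^ (- 1))%:E * \int[lebesgue_measure]_t ((`|t| ^+ n)%:E * F (t *: z)%R)))%E.
Proof.
move=> mF F0 F00.
have mFs : measurable_fun [set: measurableTypeR R * 'rV[R]_n.+1] (fun p => F p.2).
  exact: measurableT_comp mF measurable_snd.
pose h z : R := if (1 <= enorm z) && (enorm z < 2) then enorm z `^ (- 1) else 0.
have h0 z : 0 <= h z by rewrite /h; case: ifP => // _; exact: powR_ge0.
have mh : measurable_fun [set: 'rV[R]_n.+1] (h : _ -> measurableTypeR R).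
  have me := @measurable_enorm R n.+1.
  apply: measurable_fun_ifT.
  - by apply: measurable_and; [exact: measurable_fun_ler|exact: measurable_fun_ltr].
  - by apply: (measurableT_comp (measurable_powR (- 1))).
  - exact: measurable_cst.
pose G (p : measurableTypeR R * 'rV[R]_n.+1) : \bar R := (F p.2 * (kern p.1 p.2)%:E)%E.
have mG : measurable_fun setT G.
  by apply: emeasurable_funM => //; exact/measurable_EFinP.
have G0 p : (0 <= G p)%E by rewrite mule_ge0// ?F0// lee_fin.
pose H (p : measurableTypeR R * 'rV[R]_n.+1) : \bar R :=
  ((h p.2)%:E * ((`|p.1 : R| ^+ n)%:E * F ((p.1 : R) *: p.2)))%E.
have mFsc := measurable_line_fun mF.
have mH : measurable_fun setT H.
  apply: emeasurable_funM; last exact: mFsc.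
  apply/measurable_EFinP; exact: measurableT_comp mh measurable_snd.
have H0 p : (0 <= H p)%E.
  by rewrite mule_ge0// ?lee_fin// mule_ge0// lee_fin exprn_ge0.
transitivity (\int[lebesgue_rV n.+1]_y \int[lebesgue_measure]_t G (t, y))%E.
  apply: eq_integral => y _; rewrite /G /=.
  have mk : measurable_fun setT (fun t : measurableTypeR R => (kern t y)%:E).
    by apply/measurable_EFinP; exact: (measurableT_comp measurable_kern (pair2_measurable y)).
  rewrite ge0_integralZl//; last by move=> t _; rewrite lee_fin.
  have [->|y0] := eqVneq y 0; first by rewrite F00 mul0e.
  by rewrite integral_kern// mule1.
rewrite -(@fubini_tonelli _ _ _ _ R lebesgue_measure (lebesgue_rV n.+1) _ mG G0).
transitivity (\int[lebesgue_measure]_t \int[lebesgue_rV n.+1]_z H (t, z))%E.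
  apply: eq_integral => t _; rewrite /G /H /=.
  have [->|t0] := eqVneq t 0.
    transitivity (0 : \bar R)%E.
      apply: integral0_eq => y _; rewrite /kern normr0 mulr0 ltNge enorm_ge0 /=.
      by rewrite mule0.
    by apply/esym/integral0_eq => y _; rewrite scale0r F00 !mule0.
  have t1 : 0 < `|t| by rewrite normr_gt0.
  have mGt : measurable_fun setT (fun y : 'rV[R]_n.+1 => F y * (kern t y)%:E)%E.
    exact: (measurableT_comp mG (pair1_measurable t)).
  rewrite (ge0_integral_lebesgue_rV_scale t0 mGt (fun y => G0 (t, y))).
  rewrite -ge0_integralZl_EFin; first last.
  - by apply: exprn_ge0; exact: ltW.
  - by apply: (measurableT_comp mGt); exact: measurable_scale_rV.
  - by move=> z _; exact: (G0 (t, t *: z)).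
  - exact: measurableT.
  apply: eq_integral => z _; rewrite /kern /h enormZ [2 * _]mulrC ltr_pM2l//.
  rewrite -[X in X <= _]mulr1 ler_pM2l// andbC.
  case: ifP => _; last by rewrite mule0 mul0e mule0.
  rewrite powRM ?normr_ge0 ?enorm_ge0// (powR_inv1 (normr_ge0 t)).
  rewrite muleA [in RHS]muleA [in LHS]muleAC -!EFinM; congr (_%:E * _)%E.
  by rewrite exprS; field; exact: lt0r_neq0.
rewrite (@fubini_tonelli _ _ _ _ R lebesgue_measure (lebesgue_rV n.+1) _ mH H0).
rewrite [RHS]integral_mkcond; apply: eq_integral => z _.
rewrite patchE /H /=.
have mHz : measurable_fun setT
    (fun t : measurableTypeR R => (`|t| ^+ n)%:E * F ((t : R) *: z))%E.
  exact: (measurableT_comp mFsc (pair2_measurable z)).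
rewrite ge0_integralZl_EFin//; last by move=> t _; rewrite mule_ge0// lee_fin exprn_ge0.
rewrite /h; have [za|za] := boolP (z \in annulus).
  by rewrite ifT//; move: za; rewrite inE.
by rewrite ifF ?mul0e//; apply: contraNF za => za; rewrite inE.
Qed.

Lemma measurable_line_integral (F : 'rV[R]_n.+1 -> \bar R) :
  measurable_fun [set: 'rV[R]_n.+1] F -> (forall y, 0 <= F y)%E ->
  measurable_fun [set: 'rV[R]_n.+1] (fun z =>
    (enorm z `^ (- 1))%:E * \int[lebesgue_measure]_t ((`|t| ^+ n)%:E * F (t *: z)%R))%E.
Proof.
move=> mF F0; apply: emeasurable_funM.
  apply/measurable_EFinP.
  exact: measurableT_comp (measurable_powR _) (@measurable_enorm R n.+1).
have mFsc := measurable_line_fun mF.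
apply: (@measurable_fun_fubini_tonelli_G _ _ _ _ _ lebesgue_measure _ mFsc) => p.
by rewrite mule_ge0// lee_fin exprn_ge0.
Qed.

End lines.

Arguments annulus {R} n.

(** * The kernel of the fractional Laplacian *)

Section kernel.
Context {R : realType} (n : nat) (s : R).
Hypotheses (s0 : 0 < s) (s1 : s < 1).
Implicit Types (y z : 'rV[R]_n.+1) (t e : R) (f : 'rV[R]_n.+1 -> R).

Local Notation mu := (@lebesgue_rV R n.+1).

Definition outer_ball e : set 'rV[R]_n.+1 := [set y | e < enorm y].

Definition riesz y : R := enorm y `^ (- (n.+1%:R + 2 * s)).

(** The one-dimensional kernel left on a line by the Jacobian: [|t|^n riesz (t z) = riesz z *
    riesz_line |t|] for nonzero [t]. *)
Definition riesz_line t : R := t `^ (- (1 + 2 * s)).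

Lemma riesz_ge0 y : 0 <= riesz y. Proof. exact: powR_ge0. Qed.

Lemma measurable_outer_ball e : measurable (outer_ball e).
Proof.
apply: open_measurable_rV; rewrite (_ : outer_ball e = enorm @^-1` `]e, +oo[).
  by move/continuousP: (@enorm_continuous R n.+1); apply; exact: interval_open.
by apply/seteqP; split => y; rewrite /outer_ball /= in_itv /= andbT.
Qed.

Lemma measurable_riesz : measurable_fun [set: 'rV[R]_n.+1] (riesz : _ -> measurableTypeR R).
Proof. exact: measurableT_comp (measurable_powR _) (@measurable_enorm R n.+1). Qed.

Lemma measurable_annulus : measurable (@annulus R n).
Proof.
rewrite (_ : annulus n = ~` outer_ball 2 `&` enorm @^-1` `[1, 2[).
  apply: measurableI; first exact: measurableC (measurable_outer_ball _).
  by rewrite -[X in measurable X]setTI; apply: measurable_enorm => //; exact: measurable_itv.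
apply/seteqP; split => [y /= /andP[y1 y2]|y [] /= _]; last by rewrite in_itv.
split; last by rewrite /= in_itv /= y1.
by rewrite /outer_ball /=; apply/negP; rewrite -leNgt ltW.
Qed.

Lemma annulus_lty : (mu (annulus n) < +oo)%E.
Proof.
pose A := fun _ : 'I_n.+1 => (`[- 2, 2]%classic : set (measurableTypeR R)).
apply: (@le_lt_trans _ _ (mu [set x : 'rV[R]_n.+1 | forall i, A i (x 0 i)])).
  apply: le_measure; rewrite ?inE.
  - exact: measurable_annulus.
  - rewrite (_ : mkset _ = \bigcap_(i in [set: 'I_n.+1]) (rV_coord i @^-1` A i)).
      apply: fin_bigcap_measurable => // i _; rewrite -[X in measurable X]setTI.
      by apply: measurable_rV_coord => //; exact: measurable_itv.
    by apply/seteqP; split => x /= H i; [move=> _; exact: H|exact: (H i I)].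
  - move=> x /= /andP[_ x2] i; rewrite /A /= in_itv /= -ler_norml.
    exact: le_trans (coord_le_enorm _ _) (ltW x2).
rewrite lebesgue_rV_box; last by move=> i; exact: measurable_itv.
suff : (0 <= \prod_(i < n.+1) lebesgue_measure (A i) < +oo)%E by case/andP.
elim/big_ind: _.
- by rewrite lee01 ltry.
- move=> x y /andP[x0 xy] /andP[y0 yy]; rewrite mule_ge0//=.
  by rewrite lte_mul_pinfty// ge0_fin_numE.
- by move=> i _; rewrite measure_ge0 lebesgue_measure_itv /=; case: ifP => _; rewrite ltry.
Qed.

Let cut f e : 'rV[R]_n.+1 -> \bar R := (fun y => (f y * riesz y)%:E) \_ (outer_ball e).

Lemma integral_line_riesz f e z : 0 < e -> z != 0 ->
  measurable_fun [set: 'rV[R]_n.+1] (f : _ -> measurableTypeR R) -> (forall y, 0 <= f y) ->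
  (\int[lebesgue_measure]_t ((`|t| ^+ n)%:E * cut f e (t *: z)%R) =
   (riesz z)%:E * \int[lebesgue_measure]_(t in [set t : R | (e / enorm z < `|t|)%R])
      (f (t *: z) * riesz_line `|t|)%:E)%E.
Proof.
move=> e0 z0 mf f0; have ez := enorm_gt0 z0.
have mfz : measurable_fun [set: R] (fun t => f (t *: z) * riesz_line `|t|).
  apply: measurable_funM.
    apply: (measurableT_comp mf); apply: measurable_fun_rV => i.
    rewrite (_ : _ \o _ = fun t => t * z 0 i); first exact: measurable_funM.
    by apply/funext => t; rewrite /rV_coord /= mxE.
  exact: measurableT_comp (measurable_powR _) (@normr_measurable R setT).
have mset : measurable ([set t : R | e / enorm z < `|t|] : set (measurableTypeR R)).
  rewrite (_ : mkset _ = @Num.norm _ R @^-1` `]e / enorm z, +oo[).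
    by rewrite -[X in measurable X]setTI; apply: normr_measurable => //; exact: measurable_itv.
  by apply/seteqP; split => t; rewrite /= in_itv /= andbT.
rewrite -ge0_integralZl_EFin; first last.
- exact: riesz_ge0.
- by apply/measurable_EFinP; exact: measurable_funTS.
- by move=> t _; rewrite lee_fin; apply: mulr_ge0; [exact: f0|exact: powR_ge0].
- exact: mset.
rewrite [RHS]integral_mkcond; apply: eq_integral => t _.
rewrite patchE /cut patchE.
have -> : (t *: z \in outer_ball e) = (t \in [set t : R | e / enorm z < `|t|]).
  by apply/idP/idP; rewrite !inE /outer_ball /= enormZ ltr_pdivrMr.
case: ifPn => [|_]; last by rewrite mule0.
rewrite inE /= => et.
have t0 : 0 < `|t| by apply: le_lt_trans et; rewrite divr_ge0 ?ltW.
rewrite -!EFinM; congr (_%:E).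
rewrite mulrCA [in RHS]mulrCA; congr (_ * _).
rewrite /riesz enormZ (powRM _ (normr_ge0 t) (enorm_ge0 z)) mulrA mulrC; congr (_ * _).
rewrite -powR_mulrn ?normr_ge0// -powRD ?(gt_eqF t0) ?implybT//.
by rewrite /riesz_line; congr (_ `^ _); rewrite -[n.+1%:R]natr1; ring.
Qed.

(** Each line direction [z] enters with weight [riesz z / |z|], which is at most 1 on the annulus
    since [|z| >= 1] there; an error [c] on every line therefore costs at most [c] times the measure
    of the annulus. The ball of radius [e] cuts the line at [|t| = e / |z|]. *)
Lemma le_integral_lines (f g : 'rV[R]_n.+1 -> R) (e c : R) : 0 < e -> 0 <= c ->
  measurable_fun [set: 'rV[R]_n.+1] (f : _ -> measurableTypeR R) ->
  measurable_fun [set: 'rV[R]_n.+1] (g : _ -> measurableTypeR R) ->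
  (forall y, 0 <= f y) -> (forall y, 0 <= g y) ->
  (forall z, annulus n z ->
    (\int[lebesgue_measure]_(t in [set t : R | (e / enorm z < `|t|)%R])
      (f (t *: z) * riesz_line `|t|)%:E <=
     \int[lebesgue_measure]_(t in [set t : R | (e / enorm z < `|t|)%R])
      (g (t *: z) * riesz_line `|t|)%:E + c%:E)%E) ->
  (\int[mu]_(y in outer_ball e) (f y * riesz y)%:E <=
   \int[mu]_(y in outer_ball e) (g y * riesz y)%:E + (c * fine (mu (annulus n)))%:E)%E.
Proof.
move=> e0 c0 mf mg f0 g0 fg.
have cut_ge0 h : (forall y, 0 <= h y) -> forall y, (0 <= cut h e y)%E.
  move=> h0 y; rewrite /cut patchE; case: ifP => // _.
  by rewrite lee_fin mulr_ge0// riesz_ge0.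
have mcut h : measurable_fun [set: 'rV[R]_n.+1] (h : _ -> measurableTypeR R) ->
    measurable_fun [set: 'rV[R]_n.+1] (cut h e).
  move=> mh; apply: (measurable_restrictT _ (measurable_outer_ball e)).1.
  by apply/measurable_EFinP/measurable_funTS; apply: measurable_funM => //; exact: measurable_riesz.
have cut0 h : cut h e 0 = 0%E.
  rewrite /cut patchE ifF//; apply/negbTE/negP; rewrite inE /outer_ball /= enorm0.
  by rewrite ltNge ltW.
have lines h : measurable_fun [set: 'rV[R]_n.+1] (h : _ -> measurableTypeR R) ->
    (forall y, 0 <= h y) ->
    (\int[mu]_(y in outer_ball e) (h y * riesz y)%:E =
     \int[mu]_(z in annulus n) ((enorm z `^ (- 1))%:E *
       \int[lebesgue_measure]_t ((`|t| ^+ n)%:E * cut h e (t *: z)%R)))%E.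
  move=> mh h0; rewrite [LHS]integral_mkcond.
  exact: (ge0_integral_lines (mcut h mh) (cut_ge0 h h0) (cut0 h)).
have minner h : measurable_fun [set: 'rV[R]_n.+1] (h : _ -> measurableTypeR R) ->
    (forall y, 0 <= h y) -> measurable_fun (annulus n) (fun z => (enorm z `^ (- 1))%:E *
       \int[lebesgue_measure]_t ((`|t| ^+ n)%:E * cut h e (t *: z)%R))%E.
  by move=> mh h0; apply: measurable_funTS; exact: measurable_line_integral (mcut h mh) (cut_ge0 h h0).
have inner0 h z : (forall y, 0 <= h y) -> (0 <= (enorm z `^ (- 1))%:E *
       \int[lebesgue_measure]_t ((`|t| ^+ n)%:E * cut h e (t *: z)%R))%E.
  move=> h0; apply: mule_ge0; first by rewrite lee_fin powR_ge0.
  apply: integral_ge0 => t _; apply: mule_ge0; first by rewrite lee_fin exprn_ge0.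
  exact: cut_ge0.
rewrite (lines f mf f0) (lines g mg g0).
have muA : (c * fine (mu (annulus n)))%:E = (\int[mu]_(z in annulus n) cst c%:E z)%E.
  rewrite integral_cst; last exact: measurable_annulus.
  by rewrite EFinM fineK// ge0_fin_numE// annulus_lty.
rewrite muA -ge0_integralD; first last.
- exact: measurable_cst.
- by [].
- exact: minner.
- by move=> z _; exact: inner0.
- exact: measurable_annulus.
apply: ge0_le_integral.
- exact: measurable_annulus.
- by move=> z _; exact: inner0.
- exact: minner.
- by apply: emeasurable_funD; [exact: minner|exact: measurable_cst].
- move=> z az; have /andP[z1 z2] : 1 <= enorm z < 2 by exact: az.
  have z0 : z != 0 by apply: contraTneq z1 => ->; rewrite enorm0 -ltNge.
  rewrite (integral_line_riesz e0 z0 mf f0) (integral_line_riesz e0 z0 mg g0).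
  rewrite !muleA -!EFinM.
  have w0 : 0 <= enorm z `^ (- 1) * riesz z by rewrite mulr_ge0 ?powR_ge0.
  have w1 : enorm z `^ (- 1) * riesz z <= 1.
    have le1 p : 0 <= p -> enorm z `^ (- p) <= 1.
      by move=> p0; rewrite -[leRHS](powRr0 (enorm z)) ler_powR// oppr_le0.
    apply: mulr_ile1; [exact: powR_ge0|exact: powR_ge0|exact: le1|apply: le1].
    by rewrite addr_ge0// mulr_ge0// ltW.
  apply: (le_trans (lee_wpmul2l _ (fg z az))); first by rewrite lee_fin.
  rewrite ge0_muleDr; first last.
  + by rewrite lee_fin.
  + by apply: integral_ge0 => t _; rewrite lee_fin; apply: mulr_ge0; [exact: g0|exact: powR_ge0].
  by rewrite leeD2l// -EFinM lee_fin ler_piMl.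
Qed.

(** Comparison of the constants 1 and 0 along lines: the one-dimensional tail beyond [e / |z|] is at
    most the tail beyond [e / 2]. *)
Lemma integral_riesz_lty e : 0 < e ->
  (\int[mu]_(y in outer_ball e) (riesz y)%:E < +oo)%E.
Proof.
move=> e0.
have c0 : 0 <= (e / 2) `^ (- (2 * s)) / s by rewrite divr_ge0 ?powR_ge0// ltW.
have tail (a : R) : 0 < a ->
    (\int[lebesgue_measure]_(t in [set t : R | (a < `|t|)%R]) (1 * riesz_line `|t|)%:E =
     (a `^ (- (2 * s)) / s)%:E)%E.
  move=> a0; have half (h : R -> R) : (forall t, a <= t -> h t = riesz_line t) ->
      (\int[lebesgue_measure]_(t in `[a, +oo[) (h t)%:E =
       (a `^ (- (2 * s)) / (2 * s))%:E)%E.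
    move=> hE; rewrite -integral_powR_tail//; last exact: mulr_gt0.
    by apply: eq_integral => t; rewrite inE /= in_itv /= andbT => /hE ->.
  rewrite (ge0_integral_normr_gt (ltW a0)); first last.
  - by move=> t; rewrite lee_fin mul1r; exact: powR_ge0.
  - apply/measurable_EFinP; apply: measurable_funM => //.
    exact: measurableT_comp (measurable_powR _) (@normr_measurable R setT).
  rewrite !half.
  - by rewrite -EFinD; congr (_%:E); field; exact: lt0r_neq0.
  - by move=> t a_t; rewrite normrN mul1r ger0_norm// (le_trans (ltW a0)).
  - by move=> t a_t; rewrite mul1r ger0_norm// (le_trans (ltW a0)).
have H : (\int[mu]_(y in outer_ball e) (1 * riesz y)%:E <=
    \int[mu]_(y in outer_ball e) (0 * riesz y)%:E
    + ((e / 2) `^ (- (2 * s)) / s * fine (mu (annulus n)))%:E)%E.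
  apply: (@le_integral_lines (fun=> 1) (fun=> 0)) => // z /andP[z1 z2].
  have z0 : 0 < enorm z by exact: lt_le_trans z1.
  have ez0 : 0 < e / enorm z by exact: divr_gt0.
  rewrite (tail _ ez0); under eq_integral do rewrite mul0r.
  rewrite integral0 add0e lee_fin; apply: ler_wpM2r; first by rewrite invr_ge0 ltW.
  apply: le_powRN; [by rewrite mulr_ge0// ltW|exact: divr_gt0|].
  by rewrite ler_pM2l// lef_pV2 ?posrE// ltW.
move: H; under eq_integral do rewrite mul1r.
under [X in (_ <= X + _)%E -> _]eq_integral do rewrite mul0r.
by rewrite integral0 add0e => h; exact: le_lt_trans h (ltry _).
Qed.

End kernel.

(** * The barrier and its fractional Laplacian *)

Section barrier.
Context {R : realType} (n : nat) (s : R).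
Hypotheses (s0 : 0 < s) (s1 : s < 1).
Implicit Types (p x y z : 'rV[R]_n.+1) (r : R).

Local Notation mu := (@lebesgue_rV R n.+1).

(* The truncation is needed before taking the power: [powR] is 1 on negative bases. *)
Definition barrier p r y : R := Num.max 0 (r ^+ 2 - enorm (y - p) ^+ 2) `^ s.

(** The constant of [line_quadratic_bound] with [k = |z|^2 <= 4], for which [k^s <= 4], plus 1 to
    absorb the vanishing truncation error, times the measure of the directions. *)
Definition barrier_bound : R :=
  (2 * (4 / (1 - s) + 4 / s) + 1) * fine (mu (annulus n)).

Lemma barrier_ge0 p r y : 0 <= barrier p r y. Proof. exact: powR_ge0. Qed.

Lemma barrier_bound_ge0 : 0 <= barrier_bound.
Proof.
apply: mulr_ge0; last exact: fine_ge0.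
apply: addr_ge0 => //; apply: mulr_ge0 => //.
by apply: addr_ge0; apply: divr_ge0 => //; [rewrite subr_ge0|]; exact: ltW.
Qed.

Lemma barrier_out p r y : 0 <= r -> r <= enorm (y - p) -> barrier p r y = 0.
Proof.
move=> r0 ry; rewrite /barrier max_l; first by rewrite powR0// gt_eqF.
by rewrite subr_le0 ler_sqr// nnegrE enorm_ge0.
Qed.

Lemma barrier_le p r y : 0 <= r -> barrier p r y <= r `^ (2 * s).
Proof.
move=> r0; rewrite powRrM (powR_mulrn 2 r0); apply: le_powRl; first exact: ltW.
  by rewrite le_max lexx.
by rewrite ge_max sqr_ge0 lerBlDr lerDl sqr_ge0.
Qed.

Lemma max0_powR_continuous : continuous (fun t : R => Num.max 0 t `^ s).
Proof.
move=> t; have [t0|t0] := ltP 0 t.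
  apply: (@continuous_comp _ _ _ (fun t : R => Num.max 0 t) (fun t => t `^ s)).
    by apply: continuous_max; [exact: cst_continuous|].
  by apply: continuous_powR_pos; rewrite lt_max t0 orbT.
apply/cvgrPdist_lt => e e0.
have d0 : 0 < e `^ s^-1 by exact: powR_gt0.
have es : (e `^ s^-1) `^ s = e by rewrite -powRrM (mulVf (lt0r_neq0 s0)) powRr1// ltW.
near=> u.
have tu : `|t - u| < e `^ s^-1 by near: u; exact: cvgr_dist_lt.
rewrite (max_l t0) (powR0 (lt0r_neq0 s0)) sub0r normrN ger0_norm ?powR_ge0//.
rewrite -es; apply: gt0_ltr_powR => //.
- by rewrite nnegrE le_max lexx.
- by rewrite nnegrE ltW.
- rewrite gt_max d0 /=; apply: le_lt_trans tu; rewrite distrC.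
  by apply: le_trans (ler_norm _); rewrite lerBrDr gerDl.
Unshelve. all: by end_near. Qed.

Lemma barrier_continuous p r : continuous (barrier p r).
Proof.
move=> y; apply: (@continuous_comp _ _ _ (fun y => r ^+ 2 - enorm (y - p) ^+ 2)
  (fun t : R => Num.max 0 t `^ s)); last exact: max0_powR_continuous.
apply: continuousB; first exact: cst_continuous.
apply: (@continuous_comp _ _ _ (fun y => enorm (y - p)) (fun t : R => t ^+ 2)); last exact: exprn_continuous.
apply: (@continuous_comp _ _ _ (fun y => y - p) (@enorm R n.+1)); last exact: enorm_continuous.
by apply: continuousB; [|exact: cst_continuous].
Qed.

Lemma powR_small (q c : R) : 0 < q -> 0 <= c ->
  exists2 d, 0 < d & forall e, 0 < e <= d -> c * e `^ q <= 1.
Proof.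
move=> q0 c0; have c1 : 0 < (c + 1)^-1 by rewrite invr_gt0 ltr_wpDl.
exists ((c + 1)^-1 `^ q^-1); first exact: powR_gt0.
move=> e /andP[e0 ed].
have : e `^ q <= ((c + 1)^-1 `^ q^-1) `^ q by apply: le_powRl ed; exact: ltW.
rewrite -powRrM (mulVf (lt0r_neq0 q0)) (powRr1 (ltW c1)) => h.
apply: (le_trans (ler_wpM2l c0 h)).
by rewrite ler_pdivrMr ?ltr_wpDl// mul1r lerDl.
Qed.

(** An upper bound for the truncated fractional Laplacian of the barrier, obtained from
    [line_quadratic_bound] on each line through [x]. The threshold [e0] depends on [x], through its
    distance to the sphere, but the bound does not depend on [x] or [r]. *)
Lemma barrier_subsolution p x r : 0 < r -> enorm (x - p) < r ->
  exists2 e0, 0 < e0 & forall e, 0 < e < e0 ->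
  (\int[mu]_(y in outer_ball e) (barrier p r x * riesz s y)%:E <=
   \int[mu]_(y in outer_ball e) (barrier p r (x + y) * riesz s y)%:E
   + barrier_bound%:E)%E.
Proof.
move=> r0 xr; pose a := r ^+ 2 - enorm (x - p) ^+ 2.
have a0 : 0 < a by rewrite subr_gt0 ltr_sqr ?nnegrE ?enorm_ge0// ltW.
(* On a line with direction [z] in the annulus, the slope is at most [4 r] in absolute value and the
   cut [e' = e / |z|] lies between [e / 2] and [e]. The truncation error is then at most
   [c1 (e / 2)^(2 - 2s)], the factor 4 coming from [e^2 = 4 (e / 2)^2]. *)
pose c1 := a `^ s * ((4 * r / a) ^+ 2 * 4 / (2 * s)).
have c10 : 0 <= c1.
  apply: mulr_ge0; first exact: powR_ge0.
  by apply: divr_ge0; [rewrite mulr_ge0// sqr_ge0|rewrite mulr_ge0// ltW].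
have q0 : 0 < 2 - 2 * s by rewrite subr_gt0 -[ltRHS]mulr1 ltr_pM2l.
have [d d0 dP] := powR_small q0 c10.
exists (Num.min (2 * d) (a / (4 * r))).
  by rewrite lt_min mulr_gt0//= divr_gt0// mulr_gt0.
move=> e /andP[e0]; rewrite lt_min => /andP[ed ea].
have mbar : measurable_fun [set: 'rV[R]_n.+1]
    ((fun y => barrier p r (x + y)) : _ -> measurableTypeR R).
  apply: continuous_measurable_rV => y.
  apply: (@continuous_comp _ _ _ (fun y => x + y) (barrier p r)); last exact: barrier_continuous.
  by apply: continuousD; [exact: cst_continuous|].
apply: (@le_integral_lines _ _ _ s0 (fun=> barrier p r x) (fun y => barrier p r (x + y))).
- exact: e0.
- apply: addr_ge0 => //; apply: mulr_ge0 => //.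
  by apply: addr_ge0; apply: divr_ge0 => //; [rewrite subr_ge0|]; exact: ltW.
- exact: measurable_cst.
- exact: mbar.
- by move=> y; exact: barrier_ge0.
- by move=> y; exact: barrier_ge0.
move=> z /andP[z1 z2].
have z0 : 0 < enorm z by exact: lt_le_trans z1.
have [b bxz bE] := enorm_line (x - p) z.
pose e' := e / enorm z.
have e'0 : 0 < e' by exact: divr_gt0.
have e'e : e' <= e by rewrite ler_pdivrMr// ler_peMr// ltW.
have ee' : e / 2 <= e' by rewrite ler_pM2l// lef_pV2 ?posrE// ltW.
have b4 : `|- b| <= 4 * r.
  rewrite normrN (le_trans bxz)//.
  have -> : 4 * r = 2 * (r * 2) by ring.
  by rewrite ler_pM2l// ler_pM ?enorm_ge0// ltW.
have be : `|- b| * e' < a.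
  apply: (@le_lt_trans _ _ (4 * r * e)); first by apply: ler_pM => //; exact: ltW.
  by rewrite mulrC -ltr_pdivlMr// mulr_gt0.
have k0 : 0 < enorm z ^+ 2 by rewrite exprn_gt0.
have h := line_quadratic_bound s0 s1 a0 k0 e'0 be.
have barx : barrier p r x = a `^ s by rewrite /barrier max_r// ltW.
have barl t : barrier p r (x + t *: z) =
    Num.max 0 (a + - b * t - enorm z ^+ 2 * t ^+ 2) `^ s.
  rewrite /barrier; congr (Num.max _ _ `^ _).
  have -> : x + t *: z - p = (x - p) + t *: z by rewrite addrAC.
  by rewrite bE /a; ring.
under [X in (_ <= X + _)%E]eq_integral do rewrite barl.
rewrite barx; apply: (le_trans h); apply: leeD; first exact: lexx.
rewrite lee_fin; apply: lerD.
  have ks : (enorm z ^+ 2) `^ s <= 4.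
    have k4 : enorm z ^+ 2 <= 4.
      have -> : 4 = 2 ^+ 2 :> R by ring.
      by rewrite ler_sqr ?nnegrE ?enorm_ge0// ltW.
    apply: (le_trans (le_powRl (ltW s0) (ltW k0) k4)).
    by apply: ler1_powR; [rewrite ler1n|exact: ltW].
  rewrite ler_pM2l//; apply: lerD; rewrite ler_pM2r ?invr_gt0 ?subr_gt0//.
have e2d : 0 < e / 2 <= d.
  by rewrite divr_gt0//= ler_pdivrMr// mulrC ltW.
apply: le_trans (dP _ e2d).
rewrite /c1 -[leRHS]mulrA; apply: ler_wpM2l; first exact: powR_ge0.
have -> : (e / 2) `^ (2 - 2 * s) = (e / 2) ^+ 2 * (e / 2) `^ (- (2 * s)).
  have e20 : 0 < e / 2 by rewrite divr_gt0.
  by rewrite -powR_mulrn ?ltW// -powRD// (gt_eqF e20) implybT.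
have -> : (4 * r / a) ^+ 2 * 4 / (2 * s) * ((e / 2) ^+ 2 * (e / 2) `^ (- (2 * s)))
   = (4 * r / a * e) ^+ 2 * (e / 2) `^ (- (2 * s)) / (2 * s).
  by field; rewrite !lt0r_neq0.
apply: ler_wpM2r; first by rewrite invr_ge0 mulr_ge0// ltW.
apply: ler_pM; [exact: sqr_ge0|exact: powR_ge0| |].
- rewrite ler_sqr ?nnegrE; last 2 first.
  + by rewrite mulr_ge0 ?divr_ge0// ltW.
  + by rewrite mulr_ge0 ?divr_ge0 ?mulr_ge0// ltW.
  apply: ler_pM => //; [by rewrite divr_ge0// ltW|exact: ltW|].
  by apply: ler_wpM2r => //; rewrite invr_ge0 ltW.
- by apply: le_powRN => //; [rewrite mulr_ge0// ltW|rewrite divr_gt0].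
Qed.

End barrier.

(** * Real-valued integrals against the kernel *)

Section weighted_integral.
Context {R : realType} (n : nat) (s : R).
Hypotheses (s0 : 0 < s) (s1 : s < 1).
Implicit Types (w x y : 'rV[R]_n.+1) (f g : 'rV[R]_n.+1 -> R) (e k : R).

Local Notation mu := (@lebesgue_rV R n.+1).

Definition bounded_measurable f :=
  measurable_fun [set: 'rV[R]_n.+1] (f : _ -> measurableTypeR R) /\
  exists B, forall y, `|f y| <= B.

(** Real-valued, so that inequalities can be combined linearly; by [EFin_rint] it agrees with the
    extended integral for bounded measurable functions. *)
Definition rint e f : R :=
  (\int[mu]_(y in outer_ball e) (f y * riesz s y))%R.

Lemma integrable_riesz e f : 0 < e -> bounded_measurable f ->
  mu.-integrable (outer_ball e) (EFin \o (fun y => f y * riesz s y)).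
Proof.
move=> e0 [mf [B fB]].
have B0 : 0 <= B by apply: le_trans (fB 0).
have mr := @measurable_riesz R n s.
have mo := @measurable_outer_ball R n e.
apply: (@le_integrable _ _ _ mu _ mo _ (EFin \o (fun y => B * riesz s y))).
- by apply/measurable_EFinP/measurable_funTS; exact: measurable_funM.
- move=> y _; rewrite /= lee_fin !normrM (ger0_norm B0).
  by apply: ler_wpM2r; [exact: normr_ge0|exact: fB].
- apply/integrableP; split.
    by apply/measurable_EFinP/measurable_funTS; exact: measurable_funM.
  rewrite (eq_integral (fun y => B%:E * (riesz s y)%:E)%E); last first.
    by move=> y _; rewrite /= ger0_norm ?EFinM// mulr_ge0// riesz_ge0.
  rewrite ge0_integralZl_EFin; first last.
  + exact: B0.
  + by apply/measurable_EFinP; exact: measurable_funTS.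
  + by move=> y _; rewrite lee_fin; exact: riesz_ge0.
  + exact: mo.
  rewrite lte_mul_pinfty// ?lee_fin//; exact: integral_riesz_lty.
Qed.

Lemma EFin_rint e f : 0 < e -> bounded_measurable f ->
  (\int[mu]_(y in outer_ball e) (f y * riesz s y)%:E = (rint e f)%:E)%E.
Proof.
move=> e0 bf; rewrite /rint /Rintegral fineK//.
apply: (integrable_fin_num _ (integrable_riesz e0 bf)); exact: measurable_outer_ball.
Qed.

Lemma rintD e f g : 0 < e -> bounded_measurable f -> bounded_measurable g ->
  rint e (fun y => f y + g y) = rint e f + rint e g.
Proof.
move=> e0 bf bg; rewrite /rint.
rewrite -(RintegralD (@measurable_outer_ball R n e) (integrable_riesz e0 bf) (integrable_riesz e0 bg)).
by apply: eq_Rintegral => y _; rewrite mulrDl.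
Qed.

Lemma rintZ e k f : 0 < e -> bounded_measurable f ->
  rint e (fun y => k * f y) = k * rint e f.
Proof.
move=> e0 bf; rewrite /rint.
rewrite -(RintegralZl k (@measurable_outer_ball R n e) (integrable_riesz e0 bf)).
by apply: eq_Rintegral => y _; rewrite mulrA.
Qed.

Lemma le_rint e f g : 0 < e -> bounded_measurable f -> bounded_measurable g ->
  (forall y, outer_ball e y -> f y <= g y) -> rint e f <= rint e g.
Proof.
move=> e0 bf bg fg; apply: (le_Rintegral (@measurable_outer_ball R n e)
  (integrable_riesz e0 bf) (integrable_riesz e0 bg)) => y ey.
by apply: ler_wpM2r; [exact: riesz_ge0|exact: fg].
Qed.

Lemma bounded_measurableD f g : bounded_measurable f -> bounded_measurable g ->
  bounded_measurable (fun y => f y + g y).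
Proof.
move=> [mf [B fB]] [mg [C gC]]; split; first exact: measurable_funD.
by exists (B + C) => y; rewrite (le_trans (ler_normD _ _))// lerD.
Qed.

Lemma bounded_measurableZ k f : bounded_measurable f ->
  bounded_measurable (fun y => k * f y).
Proof.
move=> [mf [B fB]]; split; first exact: measurable_funM.
by exists (`|k| * B) => y; rewrite normrM ler_wpM2l.
Qed.

Lemma bounded_measurable_cst k : bounded_measurable (fun=> k).
Proof. by split; [exact: measurable_cst|exists `|k|]. Qed.

Lemma bounded_measurable_indic (A : set 'rV[R]_n.+1) : measurable A ->
  bounded_measurable (\1_A : _ -> R).
Proof.
move=> mA; split; first exact: measurable_indic.
by exists 1 => y; rewrite indicE; case: (y \in A); rewrite ?normr1 ?normr0.
Qed.

Lemma rint_indic e (A : set 'rV[R]_n.+1) : 0 < e -> measurable A ->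
  ((rint e \1_A)%:E = \int[mu]_(y in outer_ball e `&` A) (riesz s y)%:E)%E.
Proof.
move=> e0 mA; rewrite -EFin_rint//; last exact: bounded_measurable_indic.
rewrite integral_mkcondr; apply: eq_integral => y _.
by rewrite patchE indicE; case: (y \in A); rewrite ?mul1r ?mul0r.
Qed.

Lemma rint_lin_le e a b c (f g h f' g' : 'rV[R]_n.+1 -> R) : 0 < e ->
  bounded_measurable f -> bounded_measurable g -> bounded_measurable h ->
  bounded_measurable f' -> bounded_measurable g' ->
  (forall y, outer_ball e y -> f y + (a * g y + b * h y) <= c * f' y + a * g' y) ->
  rint e f + (a * rint e g + b * rint e h) <= c * rint e f' + a * rint e g'.
Proof.
move=> e0 bf bg bh bf' bg' le.
have [bag bbh] := (bounded_measurableZ a bg, bounded_measurableZ b bh).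
have [bcf bag'] := (bounded_measurableZ c bf', bounded_measurableZ a bg').
rewrite -(rintZ a e0 bg) -(rintZ b e0 bh) -(rintZ c e0 bf') -(rintZ a e0 bg').
rewrite -(rintD e0 bag bbh) -(rintD e0 bf (bounded_measurableD bag bbh)).
rewrite -(rintD e0 bcf bag').
apply: (le_rint e0 _ _ le).
- exact: bounded_measurableD bf (bounded_measurableD bag bbh).
- exact: bounded_measurableD.
Qed.

Lemma rint_leD e k f g : 0 < e -> bounded_measurable f -> bounded_measurable g ->
  (\int[mu]_(y in outer_ball e) (f y * riesz s y)%:E <=
   \int[mu]_(y in outer_ball e) (g y * riesz s y)%:E + k%:E)%E ->
  rint e f <= rint e g + k.
Proof. by move=> e0 bf bg; rewrite (EFin_rint e0 bf) (EFin_rint e0 bg) -EFinD lee_fin. Qed.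

Definition riesz_tail e : R := fine (\int[mu]_(y in outer_ball e) (riesz s y)%:E)%E.

Lemma rint_outer_ball e k : 0 < e -> 0 < k ->
  rint e \1_(outer_ball k) <= riesz_tail k.
Proof.
move=> e0 k0; have mo := @measurable_outer_ball R n.
rewrite -lee_fin (rint_indic e0 (mo k)) /riesz_tail fineK; last first.
  rewrite ge0_fin_numE ?integral_riesz_lty//.
  by apply: integral_ge0 => y _; rewrite lee_fin; exact: riesz_ge0.
apply: ge0_subset_integral.
- exact: measurableI.
- exact: mo.
- by apply/measurable_EFinP/measurable_funTS; exact: measurable_riesz.
- by move=> y _; rewrite lee_fin; exact: riesz_ge0.
- exact: subIsetr.
Qed.

(** A cube in place of a Euclidean ball, as its measure is explicit. *)
Definition box w k : set 'rV[R]_n.+1 := [set y | forall i, `|y 0 i - w 0 i| < k].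

Lemma measurable_box w k : measurable (box w k).
Proof.
rewrite (_ : box w k = \bigcap_(i in [set: 'I_n.+1])
    (rV_coord i @^-1` ball (w 0 i : R) k)).
  apply: fin_bigcap_measurable => // i _; rewrite -[X in measurable X]setTI.
  by apply: measurable_rV_coord => //; exact: measurable_ball.
apply/seteqP; split => [x xq i _|x xq i].
  by rewrite /= /ball /= distrC; exact: xq.
by rewrite distrC; exact: (xq i I).
Qed.

Lemma lebesgue_box w k : 0 < k -> (mu (box w k) = ((2 * k) ^+ n.+1)%:E)%E.
Proof.
move=> k0.
have := @lebesgue_rV_box R n.+1 (fun i => ball (w 0 i : R) k) (fun i => measurable_ball _ _).
rewrite (_ : [set x | _] = box w k); last first.
  by apply/seteqP; split => x xq i; have := xq i; rewrite /= /ball /= distrC.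
move=> ->; under eq_bigr do rewrite (lebesgue_measure_ball _ (ltW k0)).
by rewrite prodEFin prodr_const card_ord mulr_natl.
Qed.

(** With N = n + 1, the product of the kernel value [(2r)^(-(N + 2s))] and of the volume
    [(r / (2N))^N] of a cube, divided by [r^(-2s)]. *)
Definition box_mass : R := 2 `^ (- (n.+1%:R + 2 * s)) / (2 * n.+1%:R) ^+ n.+1.

Lemma box_mass_gt0 : 0 < box_mass.
Proof. by rewrite divr_gt0 ?powR_gt0// exprn_gt0// mulr_gt0. Qed.

Lemma enorm_box w k y : box w k y -> enorm (y - w) <= n.+1%:R * k.
Proof. by move=> yb; apply: enorm_le_coord => i; rewrite !mxE ltW. Qed.

(** The half-width [r / (4 (n + 1))] keeps the cube within Euclidean distance [r / 4] of [w]. It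
    therefore avoids the truncation ball and stays in the ball of radius [2 r], where the kernel is
    at least [(2r)^(-(n + 1 + 2s))]. *)
Lemma rint_box e r w : 0 < e -> e < r / 4 -> r / 2 <= enorm w <= r ->
  box_mass * r `^ (- (2 * s)) <= rint e \1_(box w (r / (4 * n.+1%:R))).
Proof.
move=> e0 er /andP[wr wr'].
have r0 : 0 < r by rewrite -(@pmulr_lgt0 _ 4^-1) ?invr_gt0//; exact: lt_trans er.
have N0 : 0 < n.+1%:R :> R by rewrite ltr0n.
set k := r / (4 * n.+1%:R); have k0 : 0 < k by rewrite divr_gt0// mulr_gt0.
have mb := measurable_box w k.
have Nk : n.+1%:R * k = r / 4 by rewrite /k; field; exact: lt0r_neq0.
have bk y : box w k y -> r / 4 <= enorm y <= 2 * r.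
  move=> /enorm_box; rewrite Nk => yw.
  have h1 := ler_enormB w y; have h2 := ler_enormD (y - w) w.
  have h3 : enorm (w - y) = enorm (y - w) by rewrite -opprB enormN.
  rewrite subrK in h2; rewrite h3 in h1.
  by apply/andP; split; lra.
rewrite -lee_fin (rint_indic e0 mb) (_ : outer_ball e `&` _ = box w k); last first.
  by apply/setIidr => y /bk/andP[h _]; exact: lt_le_trans h.
have -> : box_mass * r `^ (- (2 * s)) = (2 * r) `^ (- (n.+1%:R + 2 * s)) * (2 * k) ^+ n.+1.
  have -> : 2 * k = r / (2 * n.+1%:R) by rewrite /k; field; exact: lt0r_neq0.
  rewrite /box_mass (powRM _ (ler0n R 2) (ltW r0)) expr_div_n.
  have -> : r `^ (- (2 * s)) = r `^ (- (n.+1%:R + 2 * s)) * r ^+ n.+1.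
    rewrite -(powR_mulrn n.+1 (ltW r0)) -powRD; last by rewrite (gt_eqF r0) implybT.
    by congr (_ `^ _); ring.
  by rewrite mulrACA mulrA [X in _ = X]mulrA; ring.
rewrite EFinM -(lebesgue_box w k0) -integral_cst//.
apply: ge0_le_integral.
- exact: mb.
- by move=> y _; rewrite lee_fin powR_ge0.
- exact: measurable_cst.
- by apply/measurable_EFinP/measurable_funTS; exact: measurable_riesz.
- move=> y /bk/andP[h1 h2]; rewrite lee_fin; apply: le_powRN h2.
  + by rewrite addr_ge0// mulr_ge0// ltW.
  + by apply: lt_le_trans h1; rewrite divr_gt0.
Qed.

End weighted_integral.

Lemma lin_combination (R : realDomainType) (a b c x1 x2 x3 x4 x5 k t q : R) :
  0 <= a -> 0 <= b -> 0 <= c ->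
  x1 + (b * x2 + c * x3) <= a * x4 + b * x5 ->
  x5 <= x2 + k -> x4 <= t -> q <= x3 -> x1 <= a * t + (b * k - c * q).
Proof.
move=> a0 b0 c0 main /(ler_wpM2l b0) h1 /(ler_wpM2l a0) h2 /(ler_wpM2l c0) h3.
rewrite mulrDr in h1; lra.
Qed.

(** * Comparison with the barrier *)

Section comparison.
Context {R : realType} (n : nat) (s : R).
Hypotheses (s0 : 0 < s) (s1 : s < 1).
Implicit Types (p x y : 'rV[R]_n.+1) (u : 'rV[R]_n.+1 -> R).

Lemma bounded_measurable_shift u M x : continuous u -> (forall y, `|u y| <= M) ->
  bounded_measurable (fun y => u (x + y)).
Proof.
move=> cu uM; split; last by exists M.
apply: continuous_measurable_rV => y.
apply: (@continuous_comp _ _ _ (fun y => x + y) u); last exact: cu.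
by apply: continuousD; [exact: cst_continuous|].
Qed.

Lemma bounded_measurable_incr u M x : continuous u -> (forall y, `|u y| <= M) ->
  bounded_measurable (fun y => u x - u (x + y)).
Proof.
move=> cu uM; have := bounded_measurableD (bounded_measurable_cst n (u x))
  (bounded_measurableZ (- 1) (bounded_measurable_shift x cu uM)).
by congr bounded_measurable; apply/funext => y; rewrite mulN1r.
Qed.

(** At a negative minimum [x] of [v] over the closed ball, [v x - v (x + y)] is at most 0 unless
    [x + y] is far away, and at most [- m / 2] when [x + y] is near the centre. After integration,
    the far region gives the term with [M], the barrier gives [barrier_bound], and the cube near the
    centre gives the negative term with [box_mass]. *)
Lemma rint_at_min u p x (M m eps r rho : R) :
  continuous u -> (forall y, `|u y| <= M) -> 0 < r -> r <= rho ->
  (forall y, enorm (y - p) < 2 * rho -> 0 <= u y) ->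
  0 <= m -> 0 <= eps -> eps <= 2^-1 ->
  (forall y, enorm (y - p) < r / 2 -> m <= u y) ->
  let v y := u y - m * eps * r `^ (- (2 * s)) * barrier s p r y in
  enorm (x - p) < r -> v x < 0 -> (forall y, enorm (y - p) <= r -> v x <= v y) ->
  exists2 e0, 0 < e0 & forall e, 0 < e < e0 ->
    rint s e (fun y => u x - u (x + y)) <=
    M * riesz_tail n s rho
    + m * r `^ (- (2 * s)) * (eps * barrier_bound n s - box_mass n s / 2).
Proof.
move=> cu uM r0 rrho upos m0 eps0 eps2 um v xr vx vmin.
have M0 : 0 <= M by apply: le_trans (uM 0).
have rho0 : 0 < rho by exact: lt_le_trans rrho.
pose d := m * eps * r `^ (- (2 * s)).
have d0 : 0 <= d by rewrite !mulr_ge0// powR_ge0.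
(* The barrier is at most [r^(2s)] and [eps] at most 1/2, so [v] keeps at least half of [m] on the
   concentric half ball. *)
have dbar y : d * barrier s p r y <= m / 2.
  have dr : d * r `^ (2 * s) = m * eps.
    by rewrite /d powRN mulfVK//; exact/lt0r_neq0/powR_gt0.
  have := ler_wpM2l d0 (barrier_le s0 p y (ltW r0)); rewrite dr.
  by move=> /le_trans; apply; exact: ler_wpM2l.
have v_half y : enorm (y - p) < r / 2 -> m / 2 <= v y.
  by move=> /um h; rewrite /v -/d; have := dbar y; lra.
have v_out y : r <= enorm (y - p) -> v y = u y.
  by move=> h; rewrite /v barrier_out ?mulr0 ?subr0// ltW.
(* As [v x] is negative, [x] is outside the half ball; this gives the distance from [x] to [p] that
   [rint_box] requires. *)
have rx : r / 2 <= enorm (x - p).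
  by rewrite leNgt; apply/negP => /v_half h; move: vx; rewrite ltNge (le_trans _ h)// divr_ge0.
have [e1 e10 bars] := barrier_subsolution s0 s1 r0 xr.
exists (Num.min (r / 4) e1); first by rewrite lt_min divr_gt0.
move=> e /andP[e0]; rewrite lt_min => /andP[er ee1].
(* Increments [y] in [B] bring [x + y] into the half ball around [p]. *)
set B := box (p - x) (r / (4 * n.+1%:R)).
have mB : measurable B by exact: measurable_box.
have bB := bounded_measurable_indic mB.
have bO := bounded_measurable_indic (@measurable_outer_ball R n rho).
have bu := bounded_measurable_incr x cu uM.
have bbar : bounded_measurable (fun y => barrier s p r (x + y)).
  apply: (@bounded_measurable_shift (barrier s p r) (r `^ (2 * s))).
    exact: barrier_continuous.
  by move=> y; rewrite ger0_norm ?barrier_ge0// barrier_le// ltW.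
have bbx := bounded_measurable_cst n (barrier s p r x).
have main : rint s e (fun y => u x - u (x + y)) +
    (d * rint s e (fun y => barrier s p r (x + y)) + m / 2 * rint s e \1_B) <=
    M * rint s e \1_(@outer_ball R n rho) + d * rint s e (fun _ : 'rV[R]_n.+1 => barrier s p r x).
  apply: (rint_lin_le s0 e0 bu bbar bB bO bbx).
  move=> y ey.
  (* Four cases. For [y] in [B], [v (x + y) >= m / 2]. Elsewhere in the closed ball, minimality
     applies. Outside it but within [2 rho] of [p], [v = u >= 0]. Beyond that, [|y| > rho] because
     [|x - p| < r <= rho], and [v = u >= - M]. *)
  suff : v x - v (x + y) + m / 2 * \1_B y <= M * \1_(outer_ball rho) y.
    rewrite /v -/d; move: (barrier s p r x) (barrier s p r (x + y)) => b1 b2.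
    set A := M * _; set C := m / 2 * _; move: A C (u x) (u (x + y)) => A C u1 u2 h.
    by clear -h; lra.
  have O0 : 0 <= M * \1_(outer_ball rho) y by rewrite mulr_ge0// indicE.
  have N0 : 0 < n.+1%:R :> R by rewrite ltr0n.
  have [yB|yB] := boolP (y \in B).
    have xyp : enorm (x + y - p) < r / 2.
      have : enorm (x + y - p) <= n.+1%:R * (r / (4 * n.+1%:R)).
        have -> : x + y - p = y - (p - x) by rewrite opprB addrCA addrA.
        by move: yB; rewrite inE => /enorm_box.
      have -> : n.+1%:R * (r / (4 * n.+1%:R)) = r / 4 by field; exact: lt0r_neq0.
      by move=> /le_lt_trans; apply; lra.
    rewrite indicE yB mulr1 (le_trans _ O0)//.
    move: (v_half _ xyp) vx; move: (v (x + y)) (v x) => b a h1 h2.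
    by clear -h1 h2; lra.
  rewrite [\1_B y]indicE (negbTE yB) mulr0 addr0.
  have [xyr|/ltW rxy] := leP (enorm (x + y - p)) r.
    by apply: le_trans O0; rewrite subr_le0; exact: vmin.
  rewrite (v_out _ rxy).
  have [xyrho|rhoxy] := ltP (enorm (x + y - p)) (2 * rho).
    by apply: le_trans O0; rewrite subr_le0 (le_trans (ltW vx))// upos.
  have yrho : y \in outer_ball rho.
    rewrite inE /outer_ball /=; have := ler_enormD (x - p) y.
    rewrite (addrAC x (- p) y) => h.
    by clear -h rhoxy xr rrho; lra.
  rewrite indicE yrho mulr1.
  have := uM (x + y); rewrite ler_norml => /andP[h _].
  by clear -h vx; lra.
have hb : rint s e (fun _ : 'rV[R]_n.+1 => barrier s p r x) <=
    rint s e (fun y => barrier s p r (x + y)) + barrier_bound n s.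
  by apply: (rint_leD s0 e0 bbx bbar); apply: bars; rewrite e0 ee1.
have hO : rint s e \1_(@outer_ball R n rho) <= riesz_tail n s rho.
  exact: (rint_outer_ball n s0 e0 rho0).
have hB : box_mass n s * r `^ (- (2 * s)) <= rint s e \1_B.
  by apply: rint_box => //; rewrite -opprB enormN rx ltW.
have m20 : 0 <= m / 2 by rewrite divr_ge0.
have -> : m * r `^ (- (2 * s)) * (eps * barrier_bound n s - box_mass n s / 2) =
  d * barrier_bound n s - m / 2 * (box_mass n s * r `^ (- (2 * s))).
  by rewrite /d; field.
exact: (lin_combination M0 d0 m20 main hb hO hB).
Qed.

End comparison.

(** * Lower bound by the barrier in an interior ball *)

Section lower_bound.
Context {R : realType} (n : nat) (s : R).
Hypotheses (s0 : 0 < s) (s1 : s < 1).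
Implicit Types (p x y : 'rV[R]_n.+1) (u : 'rV[R]_n.+1 -> R).

Lemma frac_laplacian_rint (c l M : R) u x : continuous u -> (forall y, `|u y| <= M) ->
  is_frac_laplacian c s u x l ->
  c * rint s e (fun y => u x - u (x + y)) @[e --> 0^'+] --> l.
Proof.
move=> cu uM /fine_cvg; apply: cvg_trans; apply: near_eq_cvg; near=> e.
have e0 : 0 < e by near: e; exact: nbhs_right_gt.
have bu := bounded_measurable_incr x cu uM; rewrite /=.
have -> : (\int[lebesgue_rV n.+1]_(y in [set y | (e < enorm y)%R])
      ((u x - u (x + y)) / enorm y `^ (n.+1%:R + 2 * s))%:E =
    (rint s e (fun y => u x - u (x + y)))%:E)%E.
  rewrite -(EFin_rint s0 e0 bu); apply: eq_integral => y _.
  by rewrite /riesz powRN.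
by rewrite -EFinM.
Unshelve. all: by end_near. Qed.

Lemma closed_ball_compact p (r : R) :
  compact [set y : 'rV[R]_n.+1 | enorm (y - p) <= r].
Proof.
apply: bounded_closed_compact.
  exists (enorm p + r); split; first exact: num_real.
  move=> M rM y /= yr; rewrite [leLHS]mx_normrE.
  have M0 : 0 <= M.
    by rewrite (le_trans _ (ltW rM))// addr_ge0 ?enorm_ge0// (le_trans (enorm_ge0 _) yr).
  apply/bigmax_leP; split => //= -[i j] _ /=; rewrite ord1.
  apply: (le_trans (coord_le_enorm y j)).
  have := ler_enormD (y - p) p; rewrite subrK => h.
  by apply: le_trans (ltW rM); rewrite addrC (le_trans h)// lerD2r.
rewrite (_ : mkset _ = (fun y => enorm (y - p)) @^-1` `]-oo, r]); last first.
  by apply/seteqP; split => y; rewrite /= in_itv.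
apply: preimage_closed; first by move=> y _; apply: continuous_comp;
  [apply: continuousB; [|exact: cst_continuous]|exact: enorm_continuous].
exact: interval_closed.
Qed.

(** The equation enters as a lower bound [- L] on the fractional Laplacian, a form that passes from
    a solution to its opposite, so both signs of the solution are covered. *)
Lemma barrier_lower_bound (c L M r0 rbar : R) (Om : set 'rV[R]_n.+1) x0 u (xr : R -> 'rV[R]_n.+1) :
  0 < c -> 0 < r0 -> continuous u -> (forall y, `|u y| <= M) ->
  (forall y, eball x0 r0 y -> 0 <= u y) ->
  (forall x, Om x -> exists2 l, - L <= l &
     c * rint s e (fun y => u x - u (x + y)) @[e --> 0^'+] --> l) ->
  interior_balls Om x0 rbar xr ->
  (forall K d : R, 0 < d -> exists2 r, 0 < r < d & K < Phi s u xr r) ->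
  exists p r d, [/\ 0 < r, 0 < d, eball p r `<=` Om, enorm (x0 - p) = r &
    forall y, eball p r y -> d * barrier s p r y <= u y].
Proof.
move=> c0 r00 cu uM upos ueq [rbar0 balls] grow.
have M0 : 0 <= M by apply: le_trans (uM 0).
(* For [r <= rho], a point within [2 rho] of the centre [p] is within [3 rho = r0] of [x0], where
   [u >= 0]. *)
pose rho := r0 / 3; have rho0 : 0 < rho by rewrite divr_gt0.
have bm0 := @box_mass_gt0 R n s.
have bb0 := @barrier_bound_ge0 R n s s0 s1.
(* The second entry makes the barrier cost at most [box_mass / 4], half of the gain [box_mass / 2]
   of the cube. *)
pose eps := Num.min 2^-1 (box_mass n s / (4 * (barrier_bound n s + 1))).
have bb1 : 0 < 4 * (barrier_bound n s + 1) by rewrite mulr_gt0// ltr_wpDl.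
have eps0 : 0 < eps by rewrite lt_min invr_gt0 ltr0n divr_gt0.
have eps2 : eps <= 2^-1 by rewrite ge_min lexx.
have epsb : eps * barrier_bound n s <= box_mass n s / 4.
  have : eps <= box_mass n s / (4 * (barrier_bound n s + 1)) by rewrite ge_min lexx orbT.
  rewrite ler_pdivlMr// => h; rewrite ler_pdivlMr//; apply: le_trans h.
  by rewrite -mulrA ler_wpM2l ?(ltW eps0)// mulrC ler_pM2l// lerDl.
(* If [Phi] exceeds [K], the remaining gain [Phi * box_mass / 4] outweighs both the far term and the
   bound [L] from the equation. *)
pose K := (`|L| / c + M * riesz_tail n s rho) * (4 / box_mass n s).
have T0 : 0 <= riesz_tail n s rho.
  by rewrite fine_ge0// integral_ge0// => y _; rewrite lee_fin riesz_ge0.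
have K0 : 0 <= K.
  apply: mulr_ge0; last by rewrite divr_ge0// ltW.
  by apply: addr_ge0; [rewrite divr_ge0// ltW|exact: mulr_ge0].
have d0 : 0 < Num.min rbar rho by rewrite lt_min rbar0.
have [r /andP[r_gt0 rlt] KPhi] := grow K _ d0.
have [rrbar rrho] : r <= rbar /\ r <= rho.
  by move: rlt; rewrite lt_min => /andP[/ltW ? /ltW ?].
have [] := balls r; first by rewrite r_gt0.
set p := xr r => pOm x0p.
have ball_pos y : enorm (y - p) < 2 * rho -> 0 <= u y.
  move=> yp; apply: upos; rewrite /eball /=.
  have := ler_enormD (y - p) (p - x0); rewrite addrA subrK => h.
  apply: (le_lt_trans h); rewrite -(opprB x0 p) enormN x0p.
  by rewrite /rho in rrho yp *; lra.
pose m := inf [set `|u y| | y in eball p (r / 2)].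
have mu_le y : enorm (y - p) < r / 2 -> m <= u y.
  move=> yp.
  have <- : `|u y| = u y.
    rewrite ger0_norm// ball_pos// (lt_trans yp)//.
    by rewrite ltr_pdivrMr// mulrC (le_lt_trans rrho)// mulrA ltr_pMl// -natrM ltr1n.
  apply: ge_inf; first by exists 0 => _ [z _ <-]; exact: normr_ge0.
  by exists y.
have rs0 : 0 < r `^ (- (2 * s)) by exact: powR_gt0.
have PhiE : Phi s u xr r = m * r `^ (- (2 * s)) by rewrite /Phi powRN.
have m0 : 0 < m by rewrite -(pmulr_lgt0 _ rs0) -PhiE (le_lt_trans K0).
exists p, r, (m * eps * r `^ (- (2 * s))); split => //.
  by rewrite !mulr_gt0.
pose v y := u y - m * eps * r `^ (- (2 * s)) * barrier s p r y.
suff : forall y, enorm (y - p) <= r -> 0 <= v y.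
  by move=> H y yp; rewrite -subr_ge0; apply: H; exact: ltW.
move=> y1 y1p; rewrite leNgt; apply/negP => vy1.
have cv : continuous v.
  move=> y.
  have cb : {for y, continuous (fun y => m * eps * r `^ (- (2 * s)) * barrier s p r y)}.
    by apply: continuousM; [exact: cst_continuous|exact: barrier_continuous].
  exact: (continuousB (cu y) cb).
(* If [v] is negative somewhere, its minimum over the closed ball is negative. On the sphere the
   barrier vanishes and [v = u >= 0], so the minimum point is interior and the equation holds
   there. *)
have [x] := @EVT_min_rV R n.+1 v _ (ex_intro _ y1 y1p) (@closed_ball_compact p r)
  (continuous_subspaceT cv).
rewrite inE /= => xp vmin.
have vx : v x < 0 by apply: le_lt_trans vy1; apply: vmin; rewrite inE.
have xr_lt : enorm (x - p) < r.
  rewrite lt_neqAle xp andbT; apply/negP => /eqP xpr.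
  move: vx; rewrite /v barrier_out// ?xpr//; last exact: ltW.
  rewrite mulr0 subr0 ltNge ball_pos// xpr (le_lt_trans rrho)//.
  by rewrite ltr_pMl// ltr1n.
have [e1 e10 bound] := rint_at_min s0 s1 cu uM r_gt0 rrho ball_pos (ltW m0) (ltW eps0) eps2
  mu_le xr_lt vx (fun y yp => vmin y (mem_set yp)).
have [l Ll cvl] := ueq x (pOm x xr_lt).
pose B := M * riesz_tail n s rho
    + m * r `^ (- (2 * s)) * (eps * barrier_bound n s - box_mass n s / 2).
(* The bound of [rint_at_min] does not depend on the truncation and passes to the limit. *)
have lB : l <= c * B.
  apply: (cvgr_to_le cvl); near=> e; rewrite ler_pM2l//; apply: bound.
  by apply/andP; split; near: e; [exact: nbhs_right_gt|exact: nbhs_right_lt].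
have BL : c * B < - `|L|.
  rewrite -ltr_pdivlMl// mulrC mulNr.
  have := KPhi; rewrite PhiE /K mulrA ltr_pdivrMr// => h.
  have P0 : 0 < m * r `^ (- (2 * s)) by rewrite mulr_gt0.
  have : m * r `^ (- (2 * s)) * (eps * barrier_bound n s - box_mass n s / 2)
     <= m * r `^ (- (2 * s)) * (- (box_mass n s / 4)).
    by rewrite ler_pM2l//; clear -epsb; lra.
  rewrite /B; move: (m * r `^ (- (2 * s))) h => P h h2.
  by clear -h h2; lra.
have := le_lt_trans (le_trans Ll lB) BL; rewrite ltrN2 => h.
by have := lt_le_trans h (ler_norm L); rewrite ltxx.
Unshelve. all: by end_near. Qed.

End lower_bound.

(** * Growth condition, distance to the boundary, and conclusion *)

Lemma limf_esup_pinfty_gt (R : realType) (f : R -> R) (K d : R) : 0 < d ->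
  limf_esup (fun r => (f r)%:E) 0^'+ = +oo%E -> exists2 r, 0 < r < d & K < f r.
Proof.
move=> d0 foo; pose V := [set r : R | 0 < r < d].
have FV : (0 : R)^'+ V.
  by near=> r; apply/andP; split; near: r; [exact: nbhs_right_gt|exact: nbhs_right_lt].
have : (K%:E < ereal_sup ((fun r => (f r)%:E) @` V))%E.
  rewrite (@lt_le_trans _ _ +oo%E) ?ltry// -foo /limf_esup.
  by apply: ereal_inf_lbound; exists V.
by move=> /ereal_sup_gt[_ [r Vr <-]]; rewrite lte_fin; exists r.
Unshelve. all: by end_near. Qed.

Lemma bdist_le (R : realType) (n : nat) (O : set 'rV[R]_n) x x0 :
  bd O x0 -> bdist O x <= enorm (x - x0).
Proof.
move=> Ox0; apply: ge_inf; last by exists x0.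
by exists 0 => _ [y _ <-]; exact: enorm_ge0.
Qed.

(** A sup-norm ball around [x] inside the open set contains no boundary point, and the Euclidean
    norm dominates the sup norm. The point [x0] makes the infimum one over a nonempty set. *)
Lemma bdist_gt0 (R : realType) (n : nat) (O : set 'rV[R]_n) x x0 :
  open O -> bd O x0 -> O x -> 0 < bdist O x.
Proof.
move=> oO Ox0 Ox.
have /nbhs_ballP[e /= e0 xe] : nbhs x O by exact: open_nbhs_nbhs.
apply: (lt_le_trans e0); apply: lb_le_inf; first by exists (enorm (x - x0)), x0.
move=> _ [y [_ yO] <-]; rewrite leNgt; apply/negP => xy; apply: yO.
rewrite (interior_id O).1//; apply: xe; split => // i j; rewrite ord1 /ball /=.
have := coord_le_enorm (x - y) j; rewrite !mxE => /le_lt_trans; exact.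
Qed.

Theorem corollary1p4 (R : realType) (n : nat) (c s : R)
    (Omega : set 'rV[R]_n.+1) (x0 : 'rV[R]_n.+1)
    (u V : 'rV[R]_n.+1 -> R) (rbar : R) (xr : R -> 'rV[R]_n.+1)
    (c_gt0 : 0 < c)
    (s_gt0 : 0 < s) (s_lt1 : s < 1)
    (Omega_C11 : C11_open Omega)
    (x0_bd : bd Omega x0)
    (u_holder : holder_loc s Omega u)
    (u_bounded : bounded_on Omega u)
    (V_measurable : measurable_fun Omega (V : _ -> measurableTypeR R))
    (V_bounded : bounded_on Omega V)
    (u_eq : forall x, Omega x -> is_frac_laplacian c s u x (V x * u x))
    (u_out : forall x, ~ Omega x -> u x = 0)
    (u_sign : exists2 r : R, 0 < r &
      (forall x, eball x0 r x -> Omega x -> 0 < u x) \/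
      (forall x, eball x0 r x -> Omega x -> u x < 0))
    (xr_balls : interior_balls Omega x0 rbar xr)
    (u_growth : grows_faster_2s s u x0 xr) :
  forall g : 'rV[R]_n.+1 -> R,
    continuous_extension Omega (fun x => `|u x| / bdist Omega x `^ s) g ->
    0 < g x0.
Proof.
move=> g [cg gE]; have [oO _] := Omega_C11.
have [cu _ _ limsup] := u_growth.
have [M0 uM0] := u_bounded; pose M := `|M0|.
have uM y : `|u y| <= M.
  have [Oy|Oy] := pselect (Omega y); first exact: le_trans (uM0 y Oy) (ler_norm _).
  by rewrite u_out// normr0 normr_ge0.
have [C VC] := V_bounded; pose L := `|C| * M.
have VuL x : Omega x -> `|V x * u x| <= L.
  move=> Ox; rewrite normrM; apply: ler_pM => //.
  exact: le_trans (VC x Ox) (ler_norm _).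
have Lap x : Omega x ->
    c * rint s e (fun y => u x - u (x + y)) @[e --> 0^'+] --> V x * u x.
  by move=> Ox; exact: (frac_laplacian_rint s_gt0 cu uM (u_eq x Ox)).
have grow (K d : R) : 0 < d -> exists2 r, 0 < r < d & K < Phi s u xr r.
  by move=> d0; exact: limf_esup_pinfty_gt.
(* Stated with [|u|] to unite the two signs: the comparison is applied to [u] or to [- u]. *)
have [p [r [d [r0 d0 pO x0p low]]]] : exists p r d, [/\ 0 < r, 0 < d,
    eball p r `<=` Omega, enorm (x0 - p) = r &
    forall y, eball p r y -> d * barrier s p r y <= `|u y|].
  have [r0 r00 [upos|uneg]] := u_sign.
    have u0 y : eball x0 r0 y -> 0 <= u y.
      move=> y0; have [Oy|Oy] := pselect (Omega y); last by rewrite u_out.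
      exact/ltW/upos.
    have ueq x : Omega x -> exists2 l, - L <= l &
        c * rint s e (fun y => u x - u (x + y)) @[e --> 0^'+] --> l.
      move=> Ox; exists (V x * u x); last exact: Lap.
      by have := VuL x Ox; rewrite ler_norml => /andP[].
    have [p [r [d [? ? ? ? low]]]] := barrier_lower_bound s_gt0 s_lt1 c_gt0 r00 cu uM u0 ueq
      xr_balls grow.
    by exists p, r, d; split => // y /low /le_trans; apply; exact: ler_norm.
  have cw : continuous (fun y => - u y) by move=> y; exact: continuousN (cu y).
  have wM y : `|- u y| <= M by rewrite normrN.
  have w0 y : eball x0 r0 y -> 0 <= - u y.
    move=> y0; have [Oy|Oy] := pselect (Omega y); last by rewrite u_out// oppr0.
    by rewrite oppr_ge0; exact/ltW/uneg.
  have weq x : Omega x -> exists2 l, - L <= l &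
      c * rint s e (fun y => - u x - - u (x + y)) @[e --> 0^'+] --> l.
    move=> Ox; exists (- (V x * u x)).
      by rewrite lerN2; apply: le_trans (ler_norm _) (VuL x Ox).
    apply: (@cvg_trans _ ((fun e => - (c * rint s e (fun y => u x - u (x + y)))) @ 0^'+));
      last exact: cvgN (Lap x Ox).
    apply: near_eq_cvg; near=> e.
    have e0 : 0 < e by near: e; exact: nbhs_right_gt.
    have := rintZ s_gt0 (- 1) e0 (bounded_measurable_incr x cu uM).
    rewrite (_ : (fun y => -1 * (u x - u (x + y))) = (fun y => - u x - - u (x + y))).
      by move=> ->; rewrite mulN1r mulrN.
    by apply/funext => y; rewrite mulN1r opprB opprK addrC.
  have wgrow (K d : R) : 0 < d -> exists2 r, 0 < r < d & K < Phi s (fun y => - u y) xr r.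
    move=> d0; have [r rd Kr] := grow K d d0; exists r => //.
    rewrite /Phi; under eq_imagel do rewrite normrN.
    exact: Kr.
  have [p [r [d [? ? ? ? low]]]] := barrier_lower_bound s_gt0 s_lt1 c_gt0 r00 cw wM w0 weq
    xr_balls wgrow.
  by exists p, r, d; split => // y /low /le_trans; apply; rewrite -normrN; exact: ler_norm.
(* At [line t] the base of the barrier is [r^2 t (2 - t) >= r (t r)], and the distance to the
   boundary is at most [t r]; the quotient [|u| / d^s] is thus at least [k] on the whole open
   segment. *)
pose k := d * r `^ s; have k0 : 0 < k by rewrite mulr_gt0// powR_gt0.
pose line (t : R) := x0 + t *: (p - x0).
have p0r : enorm (p - x0) = r by rewrite -opprB enormN.
have line_in t : 0 < t < 1 -> enorm (line t - p) = (1 - t) * r.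
  move=> /andP[t0 t1].
  have -> : line t - p = (1 - t) *: (x0 - p).
    by apply/rowP => i; rewrite !mxE; ring.
  by rewrite enormZ x0p ger0_norm// subr_ge0 ltW.
have g_line t : 0 < t < 1 -> k <= g (line t).
  move=> t01; have /andP[t0 t1] := t01.
  have lp : eball p r (line t).
    by rewrite /eball /= line_in// gtr_pMl// gtrBl.
  have lO := pO _ lp; rewrite gE//.
  have b0 : 0 < bdist Omega (line t) by exact: bdist_gt0 oO x0_bd lO.
  have btr : bdist Omega (line t) <= t * r.
    apply: (le_trans (bdist_le _ x0_bd)).
    by rewrite /line addrAC subrr add0r enormZ p0r ger0_norm// ltW.
  rewrite ler_pdivlMr ?powR_gt0//; apply: le_trans (low _ lp).
  have bs : bdist Omega (line t) `^ s <= (t * r) `^ s by apply: (le_powRl (ltW s_gt0) (ltW b0) btr).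
  have bar : (r * (t * r)) `^ s <= barrier s p r (line t).
    apply: le_powRl; [exact: ltW|by rewrite !mulr_ge0// ltW|].
    rewrite le_max line_in//; apply/orP; right; rewrite -subr_ge0.
    have -> : r ^+ 2 - ((1 - t) * r) ^+ 2 - r * (t * r) = r ^+ 2 * (t * (1 - t)) by ring.
    by rewrite mulr_ge0 ?sqr_ge0// mulr_ge0 ?subr_ge0// ltW.
  apply: (@le_trans _ _ (d * (r * (t * r)) `^ s)); last by rewrite ler_pM2l.
  have tr0 : 0 <= t * r by rewrite mulr_ge0// ltW.
  rewrite (powRM _ (ltW r0) tr0) mulrA ler_wpM2l//.
  exact: ltW.
suff kg : k <= g x0 by exact: lt_le_trans kg.
(* If [g x0 < k], continuity within the closure gives [g < k] near [x0], against the bound on the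
   segment; [t] below is chosen so that [line t] is within [e] of [x0]. *)
rewrite leNgt; apply/negP => gk.
have clx0 : closure Omega x0 by case: x0_bd.
have := (subspace_continuousP (closure Omega) g).1 cg x0 clx0 => /cvgrPdist_lt/(_ (k - g x0)).
rewrite subr_gt0 => /(_ gk).
rewrite /prop_near1 /within /= => /nbhs_ballP[e /= e0 near_x0].
pose t := Num.min (1 / 2) (e / (2 * r)).
have t0 : 0 < t by rewrite lt_min !divr_gt0// mulr_gt0.
have t1 : t < 1 by rewrite gt_min ltr_pdivrMr// mul1r ltr1n.
have t01 : 0 < t < 1 by rewrite t0.
have tr : t * r < e.
  apply: (@le_lt_trans _ _ (e / (2 * r) * r)); first by rewrite ler_pM2r// ge_min lexx orbT.
  have -> : e / (2 * r) * r = e / 2 by field; exact: lt0r_neq0.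
  by rewrite ltr_pdivrMr// ltr_pMr// ltr1n.
have lb : ball x0 e (line t).
  split => // i j; rewrite ord1 /ball /=.
  have := coord_le_enorm (x0 - line t) j; rewrite [(x0 - line t) 0 j]mxE [(- line t) 0 j]mxE.
  move=> /le_lt_trans; apply.
  by rewrite /line opprD addrA subrr sub0r enormN enormZ p0r ger0_norm// ltW.
have lO : closure Omega (line t).
  by apply: subset_closure; apply: pO; rewrite /eball /= line_in// gtr_pMl// gtrBl.
have := near_x0 _ lb lO; rewrite distrC => /(le_lt_trans (ler_norm _)).
by rewrite ltrD2r ltNge g_line.
Unshelve. all: by end_near. Qed.
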